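(* Let $\mathfrak{S}$ be an operator system and let $\mathfrak{A}=\mathrm{C}^*(\mathfrak{S})$. Assume that every irreducible $*$-representation of $\mathfrak{A}$ is a boundary representation for $\mathfrak{S}$. Let $\pi:\mathfrak{A}\to B(\mathcal{H})$ be a unital $*$-representation and let $\Pi:\mathfrak{A}\to B(\mathcal{H})$ be a unital completely positive extension of $\pi|_{\mathfrak{S}}$. The following statements are equivalent. (i) We have $\pi=\Pi$. (ii) We have $\Pi(\mathfrak{A})\subset \pi(\mathfrak{A})$. (iii) Every pure state on $\mathrm{C}^*(\Pi(\mathfrak{A}))$ restricts to a pure state on $\pi(\mathfrak{A})$. (iv) There is a family of states on $\mathrm{C}^*(\Pi(\mathfrak{A}))$ which separate $(\Pi-\pi)(\mathfrak{A})$ and restrict to pure states on $\pi(\mathfrak{A})$. (v) Every pure state on $\mathrm{C}^*(\Pi(\mathfrak{A}))$ has the unique extension property with respect to $\pi(\mathfrak{A})$. (vi) There is a family of pure states on $\mathrm{C}^*(\Pi(\mathfrak{A}))$ which separate $(\Pi-\pi)(\mathfrak{A})$ and have the unique extension property with respect to $\pi(\mathfrak{A})$.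
   Context: An operator system is a unital self-adjoint subspace $\mathfrak{S}$ of $B(\mathcal{K})$ for some Hilbert space $\mathcal{K}$; $\mathrm{C}^*(\mathfrak{S})$ is the $\mathrm{C}^*$-algebra it generates. $\mathrm{C}^*(\Pi(\mathfrak{A}))$ is the $\mathrm{C}^*$-subalgebra of $B(\mathcal{H})$ generated by $\Pi(\mathfrak{A})$. Since $\Pi$ agrees with $\pi$ on $\mathfrak{S}$, one has $\pi(\mathfrak{A})=\mathrm{C}^*(\pi(\mathfrak{S}))=\mathrm{C}^*(\Pi(\mathfrak{S}))\subset \mathrm{C}^*(\Pi(\mathfrak{A}))$. A linear map on an operator system is completely positive if all its matrix amplifications are positive. A state on an operator system is a unital completely positive map into $\mathbb{C}$. A completely positive map $\psi:\mathfrak{S}\to B(\mathcal{K})$ is pure if whenever $\phi:\mathfrak{S}\to B(\mathcal{K})$ is completely positive and $\psi-\phi$ is completely positive, then $\phi=t\psi$ for some $0\le t\le 1$; a state is pure if and only if it is an extreme point of the set of states. Let $\mathfrak{S}\subset\mathfrak{T}$ be operator systems. A completely positive map $\psi:\mathfrak{T}\to B(\mathcal{K})$ has the unique extension property with respect to $\mathfrak{S}$ if the only completely positive map $\mathfrak{T}\to B(\mathcal{K})$ extending $\psi|_{\mathfrak{S}}$ is $\psi$ itself. An irreducible $*$-representation of $\mathrm{C}^*(\mathfrak{S})$ is a boundary representation for $\mathfrak{S}$ if it has the unique extension property with respect to $\mathfrak{S}$. If $\mathfrak{V}$ is a self-adjoint subspace of a unital $\mathrm{C}^*$-algebra $\mathfrak{B}$,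 a collection $\mathcal{F}$ of states on $\mathfrak{B}$ separates $\mathfrak{V}$ if $\sup_{\psi\in\mathcal{F}}|\psi(s)|>0$ for every non-zero self-adjoint $s\in\mathfrak{V}$. *)

(* Defs.v *)
From HB Require Import structures.
From mathcomp Require Import all_boot all_order all_algebra.
From mathcomp Require Import complex.
From mathcomp Require Import boolp classical_sets functions reals ereal.
From mathcomp Require Import topology normedtype.

Set Implicit Arguments.
Unset Strict Implicit.
Unset Printing Implicit Defensive.

Import Order.TTheory GRing.Theory Num.Theory.
Import numFieldNormedType.Exports.

Local Open Scope classical_set_scope.
Local Open Scope ring_scope.
Local Open Scope complex_scope.

(* Inner products are linear in the first argument and conjugate-linear in the
   second one. *)
HB.mixin Record isHilbert (R : realType) H of CompleteNormedModule R[i] H := {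
  inner : {dot H for @Num.conj R[i]} ;
  inner_norm : forall x : H, inner x x = `|x| ^+ 2
}.

#[short(type="hilbertType")]
HB.structure Definition Hilbert (R : realType) :=
  {H of isHilbert R H & CompleteNormedModule R[i] H}.

Section BoundedOperators.
Context {R : realType} {H : hilbertType R}.
Implicit Types f g : H -> H.

Definition bounded_linear f :=
  linear f /\ exists M : R, forall x, `|f x| <= M%:C * `|x|.

Definition bounded_op : {pred (H -> H)} := mem [set f | bounded_linear f].

Lemma bounded_opP f : reflect (bounded_linear f) (f \in bounded_op).
Proof. by apply: (iffP idP); rewrite in_setE. Qed.

Lemma bounded_op_closed : subsemimod_closed bounded_op.
Proof.
split; [split|].
- apply/bounded_opP; split; first by move=> k x y; rewrite /= scaler0 addr0.
  by exists 0 => x; rewrite normr0 mul0r.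
- move=> f g /bounded_opP[lf [M Mf]] /bounded_opP[lg [N Ng]].
  apply/bounded_opP; split=> [k x y|].
    by rewrite /GRing.add /= lf lg scalerDr addrACA.
  exists (M + N) => x; rewrite rmorphD mulrDl.
  exact: le_trans (ler_normD _ _) (lerD (Mf x) (Ng x)).
- move=> c f /bounded_opP[lf [M Mf]]; apply/bounded_opP; split=> [k x y|].
    rewrite -[LHS]/(c *: f (k *: x + y)) -[RHS]/(k *: (c *: f x) + c *: f y).
    by rewrite lf scalerDr !scalerA mulrC.
  exists (Normc.normc c * M) => x; rewrite rmorphM -mulrA.
  by rewrite -[leLHS]/`|c *: f x| normrZ; exact: ler_wpM2l.
Qed.

Lemma bounded_op1 : (idfun : H -> H) \in bounded_op.
Proof. by apply/bounded_opP; split=> //; exists 1 => x; rewrite mul1r. Qed.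

Lemma bounded_op_comp f g :
  f \in bounded_op -> g \in bounded_op -> f \o g \in bounded_op.
Proof.
move=> /bounded_opP[lf [M Mf]] /bounded_opP[lg [N Ng]].
apply/bounded_opP; split=> [k x y|]; first by rewrite /= lg lf.
exists (`|M| * N) => x; rewrite rmorphM -mulrA /=.
apply: (@le_trans _ _ (`|M|%:C * `|g x|)); last by rewrite ler_wpM2l ?lecR.
by apply: le_trans (Mf _) _; rewrite ler_wpM2r ?lecR ?ler_norm.
Qed.

End BoundedOperators.

HB.instance Definition _ (R : realType) (H : hilbertType R) :=
  GRing.isSubmodClosed.Build R[i] (H -> H) (@bounded_op R H)
    bounded_op_closed.

(* The algebra B(H), with composition as product. *)
Record bop (R : realType) (H : hilbertType R) := Bop {
  bop_fun :> H -> H ;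
  bop_subproof : bop_fun \in bounded_op }.

HB.instance Definition _ (R : realType) (H : hilbertType R) :=
  [isSub for @bop_fun R H].
HB.instance Definition _ (R : realType) (H : hilbertType R) :=
  [Choice of bop H by <:].
HB.instance Definition _ (R : realType) (H : hilbertType R) :=
  [SubChoice_isSubLmodule of bop H by <:].

Section BopRing.
Context {R : realType} {H : hilbertType R}.
Implicit Types a b c : bop H.

Definition bop_one : bop H := Bop bounded_op1.
Definition bop_mul a b : bop H :=
  Bop (bounded_op_comp (bop_subproof a) (bop_subproof b)).

Let bop_mulA : associative bop_mul. Proof. by move=> a b c; exact: val_inj. Qed.
Let bop_mul1r : left_id bop_one bop_mul.
Proof. by move=> a; exact: val_inj. Qed.
Let bop_mulr1 : right_id bop_one bop_mul.
Proof. by move=> a; exact: val_inj. Qed.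
Let bop_mulDl : left_distributive bop_mul +%R.
Proof. by move=> a b c; exact: val_inj. Qed.
Let bop_mulDr : right_distributive bop_mul +%R.
Proof.
move=> a b c; apply: val_inj; apply/funext => x /=.
have /bounded_opP[la _] := bop_subproof a.
by have := la 1 (b x) (c x); rewrite !scale1r.
Qed.

HB.instance Definition _ := GRing.Zmodule_isPzRing.Build (bop H)
  bop_mulA bop_mul1r bop_mulr1 bop_mulDl bop_mulDr.

Definition opnorm a : R :=
  sup [set complex.Re `|a x| | x in [set x : H | `|x| <= 1]].

(* The adjoint exists and is unique by the Riesz representation theorem; the
   default value 0 is never used. *)
Definition adj a : bop H :=
  xget 0 [set b : bop H | forall x y : H, inner (a x) y = inner x (b y)].

End BopRing.

(* A complex vector space V together with a distinguished set of positive
   elements of M_n(V) for every n. *)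
HB.mixin Record hasMatrixOrder (R : realType) V of GRing.Lmodule R[i] V := {
  mxpos : forall n, set 'M[V]_n
}.

#[short(type="mxOrderedType")]
HB.structure Definition MxOrdered (R : realType) :=
  {V of hasMatrixOrder R V & GRing.Lmodule R[i] V}.

(* M_n(B(H)) is identified with B(H^n), where a positive operator is one with
   nonnegative quadratic form; [0 <= z] in R[i] says that z is real and
   nonnegative. *)
HB.instance Definition _ (R : realType) (H : hilbertType R) :=
  hasMatrixOrder.Build R (bop H) (fun n => [set A : 'M[bop H]_n |
    forall x : 'I_n -> H, 0 <= \sum_i \sum_j inner (A i j (x j)) (x i)]).

HB.instance Definition _ (R : realType) :=
  hasMatrixOrder.Build R R[i] (fun n => [set A : 'M[R[i]]_n |
    forall x : 'I_n -> R[i], 0 <= \sum_i \sum_j A i j * x j * (x i)^*]).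

Section OperatorSystems.
Context {R : realType}.

Definition subspace (V : lmodType R[i]) (M : set V) :=
  M 0 /\ forall (c : R[i]) u v, M u -> M v -> M (c *: u + v).

Definition opnorm_closed (H : hilbertType R) (B : set (bop H)) :=
  forall a : bop H,
    (forall e : R, 0 < e -> exists2 b, B b & opnorm (a - b) < e) -> B a.

Definition operator_system (H : hilbertType R) (S : set (bop H)) :=
  [/\ subspace S, S 1 & forall a, S a -> S (adj a)].

Definition Cstar_subalgebra (H : hilbertType R) (B : set (bop H)) :=
  [/\ subspace B, forall a b, B a -> B b -> B (a * b),
      forall a, B a -> B (adj a) & opnorm_closed B].

Definition Cstar (H : hilbertType R) (S : set (bop H)) : set (bop H) :=
  smallest (@Cstar_subalgebra H) S.

(* Maps defined on a subspace T of V are represented by functions on V, of which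
   only the values on T are relevant. *)
Definition linear_on (V W : lmodType R[i]) (T : set V) (f : V -> W) :=
  forall (c : R[i]) u v, T u -> T v -> f (c *: u + v) = c *: f u + f v.

Definition completely_positive (V W : mxOrderedType R) (T : set V)
    (f : V -> W) :=
  linear_on T f /\ forall n (A : 'M[V]_n),
    (forall i j, T (A i j)) -> mxpos n A -> mxpos n (map_mx f A).

Definition pure (V W : mxOrderedType R) (T : set V) (f : V -> W) :=
  forall g : V -> W,
    completely_positive T g -> completely_positive T (f \- g) ->
    exists2 t : R, 0 <= t <= 1 & forall a, T a -> g a = t%:C *: f a.

Definition unique_extension (V W : mxOrderedType R) (S T : set V)
    (f : V -> W) :=
  forall g : V -> W, completely_positive T g ->
    (forall a, S a -> g a = f a) -> forall a, T a -> g a = f a.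

Definition state (H : hilbertType R) (T : set (bop H)) (f : bop H -> R[i]) :=
  completely_positive T f /\ f 1 = 1.

Definition pure_state (H : hilbertType R) (T : set (bop H))
    (f : bop H -> R[i]) :=
  state T f /\ pure T f.

Definition star_representation (K H : hilbertType R) (A : set (bop K))
    (rho : bop K -> bop H) :=
  [/\ linear_on A rho,
      forall a b, A a -> A b -> rho (a * b) = rho a * rho b
    & forall a, A a -> rho (adj a) = adj (rho a)].

Definition irreducible_representation (K H : hilbertType R) (A : set (bop K))
    (rho : bop K -> bop H) :=
  [/\ star_representation A rho, exists2 a, A a & rho a != 0
    & forall M : set H, subspace M -> closed M ->
        (forall a x, A a -> M x -> M (rho a x)) -> M = [set 0] \/ M = setT].

Definition boundary_representation (K H : hilbertType R) (S : set (bop K))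
    (rho : bop K -> bop H) :=
  irreducible_representation (Cstar S) rho /\
  unique_extension S (Cstar S) rho.

Definition separates (H : hilbertType R) (F : set (bop H -> R[i]))
    (V : set (bop H)) :=
  forall s, V s -> adj s = s -> s != 0 ->
    (0 < ereal_sup [set (Normc.normc (f s))%:E | f in F])%E.

End OperatorSystems.

(* Main.v *)
From HB Require Import structures.
From mathcomp Require Import all_boot all_order all_algebra.
From mathcomp Require Import complex.
From mathcomp Require Import boolp classical_sets functions reals ereal.
From mathcomp Require Import topology normedtype sequences.
From mathcomp Require Import ring lra.
Require Import Defs.

Set Implicit Arguments.
Unset Strict Implicit.
Unset Printing Implicit Defensive.

Import Order.TTheory GRing.Theory Num.Theory.
Import numFieldNormedType.Exports.
Local Open Scope classical_set_scope.
Local Open Scope ring_scope.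
Local Open Scope complex_scope.

(** Write B for C*(Pi(A)) and D for pi(A). The heart is the passage from (iv) to
    (i). Let f be a state on B whose restriction to D is pure. Completing D with
    respect to the form f(w^* v) gives a Hilbert space on which every operator b
    acts by compression: <T_b v, w> = f(w^* b v). Purity of f on D makes
    a |-> T_(pi a) an irreducible representation of A ([pure_irreducible]), and
    a |-> T_(Pi a) is a completely positive map that agrees with it on S. As
    irreducible representations are boundary representations, the two maps
    coincide, and evaluating at the unit vector of D gives f (Pi a) = f (pi a)
    ([pure_restriction_agree]). If such states separate (Pi - pi)(A), then Pi and
    pi agree on self-adjoint elements, hence everywhere.

    The remaining implications rest on two facts about pure states. They separate
    the self-adjoint elements of an operator system ([pure_states_separate]), and
    a pure state on B with the unique extension property with respect to D
    restricts to a pure state on D, because a decomposition on D extends to B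
    ([pure_state_restrict]). Under (ii) every pure state on B has this property:
    B lies in the norm closure of D, and positive functionals are continuous.
    So (ii) gives (iii), and (i) gives (v) through (ii).

    Both facts need extensions and extreme points of sets of functionals. A
    single application of Zorn's lemma provides them: a minimal element among the
    sublinear functionals that cut out a face is linear, hence an extreme point
    of the set of functionals below the given one ([extreme_functional]). Applied
    to the supremum of the numerical range this produces pure states.

    D is contained in B because *-representations of C*-algebras are contractive
    ([representation_contractive]), which follows from the Neumann series. Completions are built as spaces of bounded antilinear functionals;
    that such a functional is a limit of vectors is an approximate form of the
    Riesz representation theorem, valid without completeness
    ([psd_near_riesz]), which also yields the exact theorem and thereby adjoints
    and projections. *)

(** * Real and imaginary parts *)

Section ComplexModulus.
Context {R : realType}.
Implicit Types z w : R[i].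
Local Notation normc := Normc.normc.

Lemma normrE z : `|z| = (normc z)%:C.
Proof. by case: z. Qed.

Lemma normc_sq z : normc z ^+ 2 = complex.Re z ^+ 2 + complex.Im z ^+ 2.
Proof. by case: z => a b /=; rewrite sqr_sqrtr // addr_ge0 ?sqr_ge0. Qed.

Lemma normc_ge0 z : 0 <= normc z.
Proof. by case: z => a b /=; exact: sqrtr_ge0. Qed.

Lemma normr_le_normc (x : R) z : x ^+ 2 <= normc z ^+ 2 -> `|x| <= normc z.
Proof. by rewrite -[x ^+ 2]real_normK ?num_real // ler_sqr ?nnegrE ?normc_ge0. Qed.

Lemma Re_le_normc z : `|complex.Re z| <= normc z.
Proof. by apply: normr_le_normc; rewrite normc_sq lerDl sqr_ge0. Qed.

Lemma Im_le_normc z : `|complex.Im z| <= normc z.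
Proof. by apply: normr_le_normc; rewrite normc_sq lerDr sqr_ge0. Qed.

Lemma normc_le_ReIm z : normc z <= `|complex.Re z| + `|complex.Im z|.
Proof.
rewrite -ler_sqr ?nnegrE ?normc_ge0 ?addr_ge0 // normc_sq.
rewrite -[complex.Re z ^+ 2]real_normK ?num_real //.
rewrite -[complex.Im z ^+ 2]real_normK ?num_real //.
have := normr_ge0 (complex.Re z); have := normr_ge0 (complex.Im z); nra.
Qed.

Lemma normcD z w : normc (z + w) <= normc z + normc w.
Proof. by have := ler_normD z w; rewrite !normrE -rmorphD /= lecR. Qed.

Lemma normcM z w : normc (z * w) = normc z * normc w.
Proof. exact: Normc.normcM. Qed.

Lemma normcN z : normc (- z) = normc z.
Proof. by case: z => a b /=; rewrite !sqrrN. Qed.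

Lemma normcJ z : normc z^*%C = normc z.
Proof. by case: z => a b /=; rewrite sqrrN. Qed.

Lemma normcR (x : R) : normc x%:C = `|x|.
Proof. by rewrite /= expr0n addr0 sqrtr_sqr. Qed.

Lemma normc0 : normc (0 : R[i]) = 0. Proof. exact: Normc.normc0. Qed.

Lemma normc_eq0 z : normc z = 0 -> z = 0. Proof. exact: Normc.eq0_normc. Qed.

Lemma cReD z w : complex.Re (z + w) = complex.Re z + complex.Re w.
Proof. by case: z w => [? ?] []. Qed.

Lemma cReN z : complex.Re (- z) = - complex.Re z. Proof. by case: z. Qed.

Lemma cReZ (x : R) z : complex.Re (x%:C * z) = x * complex.Re z.
Proof. by case: z => a b /=; rewrite mul0r subr0. Qed.

Lemma cReJ z : complex.Re z^* = complex.Re z. Proof. by case: z. Qed.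

Lemma cImJ z : complex.Im z^* = - complex.Im z. Proof. by case: z. Qed.

Lemma mulJc z : z^*%C * z = (normc z ^+ 2)%:C.
Proof.
rewrite normc_sq; case: z => a b /=; apply/eqP; rewrite eq_complex /=.
by apply/andP; split; apply/eqP; ring.
Qed.

Lemma complex_ge0P z : reflect (0 <= complex.Re z /\ complex.Im z = 0) (0 <= z).
Proof.
rewrite lecE /=; apply: (iffP andP) => [[/eqP -> ->]|[-> ->]]; by split.
Qed.

Lemma eq_ReIm z w :
  complex.Re z = complex.Re w -> complex.Im z = complex.Im w -> z = w.
Proof. by case: z w => a b [c d] /= -> ->. Qed.

(** Multiplying z by its conjugate makes it a nonnegative real number, so an
    estimate of real parts that holds for all multiples passes to the modulus. *)
Lemma normc_rotate z (C : R) :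
  (forall c, complex.Re (c * z) ^+ 2 <= C * normc c ^+ 2) ->
  normc z ^+ 2 <= C.
Proof.
move=> zC; have := zC z^*; rewrite mulJc normcJ /=.
have [z0|z0] := eqVneq (normc z) 0.
  by have := zC 1; rewrite (normc_eq0 z0) mulr0 normc0 Normc.normc1 expr1n mulr1.
rewrite [_ ^+ 2 ^+ 2]expr2 ler_pM2r // lt_def sqr_ge0 andbT.
by rewrite expf_eq0.
Qed.

(** For c > 0 the polynomial is evaluated at its minimizer - b / c; for c = 0 it
    is affine, hence constant. *)
Lemma quadratic_ge0_discr (a b c : R) :
  0 <= c -> (forall t, 0 <= a + 2 * t * b + t ^+ 2 * c) -> b ^+ 2 <= a * c.
Proof.
move=> c0 abc; have := c0; rewrite le_eqVlt => /predU1P[c0'|c_gt0].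
  rewrite -c0' mulr0; have [->|b0] := eqVneq b 0; first by rewrite expr0n.
  have := abc (- (a + 1) / (2 * b)).
  have -> : 2 * (- (a + 1) / (2 * b)) * b = - (a + 1) by field.
  by rewrite -c0' mulr0; lra.
have := abc (- b / c); rewrite -(ler_pM2r c_gt0) mul0r.
have -> : (a + 2 * (- b / c) * b + (- b / c) ^+ 2 * c) * c = a * c - b ^+ 2.
  by field; rewrite gt_eqF.
by rewrite subr_ge0.
Qed.

Lemma normc_sum (I : Type) (r : seq I) (F : I -> R[i]) :
  normc (\sum_(i <- r) F i) <= \sum_(i <- r) normc (F i).
Proof.
elim: r => [|i r IH]; first by rewrite !big_nil normc0.
by rewrite !big_cons; apply: le_trans (normcD _ _) _; rewrite lerD2l.
Qed.

End ComplexModulus.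

(** * Positive semidefinite forms *)

Record psd_form (R : realType) (V : lmodType R[i]) := PsdForm {
  psd_fun :> V -> V -> R[i] ;
  psdL : forall (c : R[i]) u v w,
    psd_fun (c *: u + v) w = c * psd_fun u w + psd_fun v w ;
  psdC : forall u v, psd_fun v u = (psd_fun u v)^* ;
  psd_ge0 : forall v, 0 <= psd_fun v v }.

Section PsdForms.
Context {R : realType} {V : lmodType R[i]} (h : psd_form V).
Implicit Types (u v w : V) (c : R[i]).
Local Notation normc := Normc.normc.
Local Notation Re := complex.Re.

Lemma psdDl u v w : h (u + v) w = h u w + h v w.
Proof. by rewrite -[u]scale1r psdL mul1r scale1r. Qed.

Lemma psd0l w : h 0 w = 0.
Proof. by have := psdDl 0 0 w; rewrite addr0 => /eqP; rewrite -subr_eq subrr => /eqP. Qed.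

Lemma psdZl c u w : h (c *: u) w = c * h u w.
Proof. by rewrite -[c *: u]addr0 psdL psd0l addr0. Qed.

Lemma psdNl u w : h (- u) w = - h u w.
Proof. by rewrite -scaleN1r psdZl mulN1r. Qed.

Lemma psdBl u v w : h (u - v) w = h u w - h v w.
Proof. by rewrite psdDl psdNl. Qed.

Lemma psdDr u v w : h w (u + v) = h w u + h w v.
Proof. by rewrite psdC psdDl rmorphD /= -!psdC. Qed.

Lemma psdZr c u w : h w (c *: u) = c^*%C * h w u.
Proof. by rewrite psdC psdZl rmorphM /= -psdC. Qed.

Lemma psd0r w : h w 0 = 0.
Proof. by rewrite psdC psd0l rmorph0. Qed.

Lemma psdNr u w : h w (- u) = - h w u.
Proof. by rewrite psdC psdNl rmorphN /= -psdC. Qed.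

Lemma psdBr u v w : h w (u - v) = h w u - h w v.
Proof. by rewrite psdDr psdNr. Qed.

Definition psdnorm v : R := Num.sqrt (Re (h v v)).

Lemma psdnorm_ge0 v : 0 <= psdnorm v. Proof. exact: sqrtr_ge0. Qed.

Lemma Re_psd_ge0 v : 0 <= Re (h v v).
Proof. by have /complex_ge0P[] := psd_ge0 h v. Qed.

Lemma psdnorm_sq v : psdnorm v ^+ 2 = Re (h v v).
Proof. by rewrite sqr_sqrtr ?Re_psd_ge0. Qed.

Lemma psd_self v : h v v = (psdnorm v ^+ 2)%:C.
Proof.
by have /complex_ge0P[_] := psd_ge0 h v; rewrite psdnorm_sq; case: (h v v) => a b /= ->.
Qed.

Lemma psdnormZ c v : psdnorm (c *: v) = normc c * psdnorm v.
Proof.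
rewrite /psdnorm psdZl psdZr mulrCA mulrA mulJc cReZ sqrtrM ?sqr_ge0 //.
by rewrite sqrtr_sqr ger0_norm ?normc_ge0.
Qed.

Lemma psdnormN v : psdnorm (- v) = psdnorm v.
Proof. by rewrite /psdnorm psdNl psdNr opprK. Qed.

Lemma psdnorm0 : psdnorm 0 = 0.
Proof. by rewrite /psdnorm psd0l sqrtr0. Qed.

Lemma psdnorm_add_sq u v (t : R) :
  psdnorm (u + t%:C *: v) ^+ 2 =
  psdnorm u ^+ 2 + 2 * t * Re (h u v) + t ^+ 2 * psdnorm v ^+ 2.
Proof.
rewrite !psdnorm_sq psdDl !psdDr !psdZl !psdZr conjc_real !cReD !cReZ.
by rewrite [h v u]psdC cReJ; ring.
Qed.

(** Positivity of the form on the line through u in the direction v bounds the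
    real part of the form, and rotating u bounds the modulus. *)
Lemma psd_CauchySchwarz u v : normc (h u v) <= psdnorm u * psdnorm v.
Proof.
rewrite -ler_sqr ?nnegrE ?normc_ge0 ?mulr_ge0 ?psdnorm_ge0 //.
apply: normc_rotate => c; rewrite -psdZl exprMn.
have -> : psdnorm u ^+ 2 * psdnorm v ^+ 2 * normc c ^+ 2 =
          psdnorm (c *: u) ^+ 2 * psdnorm v ^+ 2 by rewrite psdnormZ; ring.
apply: quadratic_ge0_discr => [|t]; first exact: sqr_ge0.
by rewrite -psdnorm_add_sq sqr_ge0.
Qed.

Lemma psdnormD u v : psdnorm (u + v) <= psdnorm u + psdnorm v.
Proof.
rewrite -ler_sqr ?nnegrE ?addr_ge0 ?psdnorm_ge0 //.
have := psdnorm_add_sq u v 1; rewrite scale1r expr1n !mul1r mulr1 => ->.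
have := le_trans (Re_le_normc (h u v)) (psd_CauchySchwarz u v).
by rewrite ler_norml; nra.
Qed.

(** A vector nearly minimizing |v|^2 - 2 Re (l v) over the subspace M nearly
    represents l on M: otherwise a small move in the direction in which the
    representation fails would decrease the functional too much. This replaces
    the Riesz representation theorem when M is not complete. *)
Lemma psd_near_riesz (M : set V) (l : V -> R[i]) (C : R) :
  subspace M -> linear_on M (l : V -> R[i]^o) ->
  (forall w, M w -> normc (l w) <= C * psdnorm w) ->
  forall e : R, 0 < e -> exists2 v, M v &
    forall w, M w -> normc (l w - h w v) <= e * psdnorm w.
Proof.
move=> [M0 ML] lL lC e e0.
have M_add u v (t : R) : M u -> M v -> M (u + t%:C *: v).
  by move=> Mu Mv; rewrite addrC; exact: ML.
have l0 : l 0 = 0.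
  have := lL 1 _ _ M0 M0; rewrite scaler0 addr0 [1 *: _]mul1r => /eqP.
  by rewrite -subr_eq subrr => /eqP.
have lZ c w : M w -> l (c *: w) = c * l w.
  by move=> Mw; have := lL c _ _ Mw M0; rewrite addr0 l0 addr0.
have lD u v (t : R) : M u -> M v -> l (u + t%:C *: v) = l u + t%:C * l v.
  by move=> Mu Mv; rewrite addrC lL // addrC.
pose J v := psdnorm v ^+ 2 - 2 * Re (l v).
have J_lb v : M v -> - C ^+ 2 <= J v.
  move=> Mv; have := le_trans (Re_le_normc (l v)) (lC v Mv).
  have := sqr_ge0 (psdnorm v - C); rewrite /J ler_norml sqrrB.
  by move=> vC /andP[_]; rewrite -mulr_natl in vC *; lra.
have JS : has_inf [set J v | v in M].
  split; first by exists (J 0), 0.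
  by exists (- C ^+ 2) => _ [v Mv <-]; exact: J_lb.
(* An excess of at most e^2 over the infimum gives an error of at most e in the
   representation. *)
have [_ [v Mv <-] Jv] := inf_adherent (exprn_gt0 2 e0) JS.
exists v => // w Mw.
rewrite -ler_sqr ?nnegrE ?normc_ge0 ?mulr_ge0 ?psdnorm_ge0 ?(ltW e0) //.
apply: normc_rotate => c; rewrite mulrBr -psdZl -lZ // !exprMn.
have Mcw : M (c *: w) by rewrite -[_ *: _]addr0; exact: ML.
have -> : e ^+ 2 * psdnorm w ^+ 2 * normc c ^+ 2 = e ^+ 2 * psdnorm (c *: w) ^+ 2.
  by rewrite psdnormZ; ring.
move: (c *: w) Mcw => {}w {}Mw; rewrite cReD cReN -sqrrN opprB.
apply: quadratic_ge0_discr => [|t]; first exact: sqr_ge0.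
have : inf [set J u | u in M] <= J (v + t%:C *: w).
  by apply: ge_inf; [exact: JS.2 | exists (v + t%:C *: w) => //; exact: M_add].
move: Jv; rewrite /J psdnorm_add_sq lD // cReD cReZ [h w v]psdC cReJ.
by lra.
Qed.

End PsdForms.

(** * Limits of numbers *)

Section Small.
Context {R : realType}.
Local Notation normc := Normc.normc.

Lemma inv_small (d : R) : 0 < d -> exists n : nat, n.+1%:R^-1 < d.
Proof.
move=> d0; have d1 : 0 < d^-1 by rewrite invr_gt0.
exists (Num.bound d^-1); rewrite invf_plt ?posrE //.
by apply: lt_trans (archi_boundP (ltW d1)) _; rewrite ltr_nat.
Qed.

Lemma le_add_small (x y C : R) :
  (forall n : nat, x <= y + C * n.+1%:R^-1) -> x <= y.
Proof.
move=> xy; apply/ler_addgt0Pr => e e0.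
have C1 : 0 < `|C| + 1 by rewrite ltr_wpDl.
have [n] := inv_small (divr_gt0 e0 C1); rewrite ltr_pdivlMr // => ne.
apply: le_trans (xy n) _; rewrite lerD2l; apply: le_trans (ltW ne).
rewrite mulrC ler_pM2l ?invr_gt0 //; apply: le_trans (ler_norm C) _.
by rewrite lerDl.
Qed.

Lemma normc_small (z : R[i]) (C : R) :
  (forall n : nat, normc z <= C * n.+1%:R^-1) -> z = 0.
Proof.
move=> zC; apply/normc_eq0/eqP; rewrite eq_le normc_ge0 andbT.
by apply: (@le_add_small _ _ C) => n; rewrite add0r.
Qed.

(** The intervals around x n of radius e n meet in the supremum of their lower
    ends. *)
Lemma real_nested (x e : nat -> R) :
  (forall n m, (n <= m)%N -> `|x m - x n| <= e n) ->
  exists l, forall n, `|l - x n| <= e n.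
Proof.
move=> xe; have xx n m : x n - e n <= x m + e m.
  case/orP: (leq_total n m) => /xe; rewrite ler_distl => /andP[? ?].
    have := le_trans (normr_ge0 _) (xe _ _ (leqnn m)); lra.
  have := le_trans (normr_ge0 _) (xe _ _ (leqnn n)); lra.
pose E := range (fun n => x n - e n).
have E_ub m : ubound E (x m + e m) by move=> _ [n _ <-].
have ES : has_sup E by split; [exists (x 0%N - e 0%N), 0%N | exists (x 0%N + e 0%N)].
exists (sup E) => n; rewrite ler_distl; apply/andP; split.
  by apply: ub_le_sup; [exact: ES.2 | exists n].
by apply: ge_sup; [exact: ES.1 | exact: E_ub].
Qed.

Lemma complex_nested (z : nat -> R[i]) (e : nat -> R) :
  (forall n m, (n <= m)%N -> normc (z m - z n) <= e n) ->
  exists l, forall n, normc (l - z n) <= 2 * e n.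
Proof.
move=> ze.
have [a aP] : exists a, forall n, `|a - complex.Re (z n)| <= e n.
  apply: real_nested => n m /ze; apply: le_trans.
  by rewrite -cReN -cReD Re_le_normc.
have [b bP] : exists b, forall n, `|b - complex.Im (z n)| <= e n.
  apply: real_nested => n m /ze; apply: le_trans.
  have -> : complex.Im (z m) - complex.Im (z n) = complex.Im (z m - z n).
    by case: (z m) (z n) => [? ?] [].
  exact: Im_le_normc.
exists (a +i* b) => n; apply: le_trans (normc_le_ReIm _) _.
by have := aP n; have := bP n; case: (z n) => p q /=; lra.
Qed.

End Small.

(** * Hilbert spaces *)

Definition hilbert_psd (R : realType) (H : hilbertType R) : psd_form H.
Proof.
refine (@PsdForm R H (fun u v => inner u v) _ _ _).
- by move=> c u v w; rewrite linearPl.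
- by move=> u v; rewrite hermitian_subproof expr0 mul1r.
- by move=> v; rewrite inner_norm exprn_ge0.
Defined.

Notation hnorm := (psdnorm (hilbert_psd _)).

Section HilbertSpaces.
Context {R : realType} {H : hilbertType R}.
Implicit Types (x y z w : H) (c : R[i]) (M : set H).
Local Notation normc := Normc.normc.
Local Notation hp := (hilbert_psd H).

Lemma innerDl x y z : inner (x + y) z = inner x z + inner y z.
Proof. exact: (psdDl hp). Qed.
Lemma innerBl x y z : inner (x - y) z = inner x z - inner y z.
Proof. exact: (psdBl hp). Qed.
Lemma innerZl c x z : inner (c *: x) z = c * inner x z.
Proof. exact: (psdZl hp). Qed.
Lemma inner0l z : inner (0 : H) z = 0.
Proof. exact: (psd0l hp). Qed.
Lemma innerNl x z : inner (- x) z = - inner x z.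
Proof. exact: (psdNl hp). Qed.
Lemma innerDr x y z : inner z (x + y) = inner z x + inner z y.
Proof. exact: (psdDr hp). Qed.
Lemma innerBr x y z : inner z (x - y) = inner z x - inner z y.
Proof. exact: (psdBr hp). Qed.
Lemma innerZr c x z : inner z (c *: x) = c^*%C * inner z x.
Proof. exact: (psdZr hp). Qed.
Lemma inner0r z : inner z (0 : H) = 0.
Proof. exact: (psd0r hp). Qed.
Lemma innerC x y : inner y x = (inner x y)^*%C.
Proof. exact: (psdC hp). Qed.
Lemma inner_self x : inner x x = (hnorm x ^+ 2)%:C.
Proof. exact: (psd_self hp). Qed.
Lemma inner_suml (I : Type) (r : seq I) (F : I -> H) z :
  inner (\sum_(i <- r) F i) z = \sum_(i <- r) inner (F i) z.
Proof.
elim: r => [|i r IH]; first by rewrite !big_nil inner0l.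
by rewrite !big_cons innerDl IH.
Qed.
Lemma inner_CauchySchwarz x y : normc (inner x y) <= hnorm x * hnorm y.
Proof. exact: (psd_CauchySchwarz hp). Qed.

Lemma hnormE x : `|x| = (hnorm x)%:C.
Proof.
have := inner_norm x; rewrite inner_self rmorphXn /= => /eqP.
by rewrite eqrXn2 ?lecR ?psdnorm_ge0 // => /eqP.
Qed.

Lemma hnorm_eq0 x : hnorm x = 0 -> x = 0.
Proof. by move=> x0; apply/normr0_eq0; rewrite hnormE x0. Qed.

Lemma inner_inj x y : (forall w, inner w x = inner w y) -> x = y.
Proof.
move=> xy; apply/eqP; rewrite -subr_eq0; apply/eqP/hnorm_eq0.
have := inner_self (x - y); rewrite innerBr xy subrr => /complexI/esym/eqP.
by rewrite expf_eq0 => /eqP.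
Qed.

Lemma hilbert_complete (u : nat -> H) (e : nat -> R) :
  (forall n m, (n <= m)%N -> hnorm (u m - u n) <= e n) ->
  (forall d, 0 < d -> exists n, e n < d) ->
  exists l, forall n, hnorm (l - u n) <= e n.
Proof.
move=> ue e0.
have /cauchy_cvg/cvg_ex[l ul] : cauchy (u @ \oo).
  apply: cauchy_exP => d /[dup] d_gt0; rewrite ltcE /= => /andP[/eqP dIm dRe].
  have [n en] := e0 _ dRe; exists (u n); exists n => // m /= nm.
  rewrite -ball_normE /= -opprB normrN hnormE.
  by rewrite ltcE /= dIm eqxx /= (le_lt_trans (ue _ _ nm)).
exists l => n; rewrite -[leLHS]subr0 lerBlDr; apply/ler_addgt0Pl => /= d d0.
have /cvgrPdist_lt/(_ d%:C) := ul; rewrite ltcR => /(_ d0)[N _ Nl].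
have := Nl (maxn N n) (leq_maxl _ _); rewrite /= hnormE ltcR => lN.
rewrite addr0 -[l](subrK (u (maxn N n))) -addrA.
apply: le_trans (psdnormD _ _ _) _; rewrite lerD //.
  exact: ltW.
exact: ue (leq_maxr _ _).
Qed.

Lemma closed_hnorm M x : closed M ->
  (forall e : R, 0 < e -> exists2 y, M y & hnorm (x - y) < e) -> M x.
Proof.
move=> Mcl xM; rewrite ((closure_id M).1 Mcl) => B /nbhs_ballP[e /= e0 eB].
have := e0; rewrite ltcE /= => /andP[/eqP eIm /xM[y My xy]]; exists y; split=> //.
by apply: eB; rewrite -ball_normE /= hnormE ltcE /= eIm eqxx.
Qed.

(** The near representatives of l form a Cauchy sequence: the difference d of
    two of them lies in M, so <d, d> is the difference of two approximations of
    l d. *)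
Lemma riesz_on M (l : H -> R[i]) (C : R) :
  subspace M -> closed M -> linear_on M (l : H -> R[i]^o) ->
  (forall w, M w -> normc (l w) <= C * hnorm w) ->
  exists2 y, M y & forall w, M w -> l w = inner w y.
Proof.
move=> Msub Mcl lL lC; have [M0 ML] := Msub.
pose e n : R := n.+1%:R^-1; have e_gt0 n : 0 < e n by rewrite invr_gt0.
have /choice[v vP] n : exists v, M v /\
    forall w, M w -> normc (l w - inner w v) <= e n * hnorm w.
  by have [v Mv vP] := psd_near_riesz Msub lL lC (e_gt0 n); exists v.
have [y yv] : exists y, forall n, hnorm (y - v n) <= 2 * e n.
  apply: hilbert_complete => [n m nm|d d0]; last first.
    have [|n] := @inv_small R (d / 2); first lra.
    by rewrite -/(e n) => en; exists n; lra.
  have Md : M (v m - v n).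
    by rewrite addrC -scaleN1r; apply: ML; [exact: (vP n).1 | exact: (vP m).1].
  have em : e m <= e n by rewrite lef_pV2 ?posrE // ler_nat.
  have [d0|d0] := eqVneq (hnorm (v m - v n)) 0; first by rewrite d0 mulr_ge0 ?ltW.
  have {}d0 : 0 < hnorm (v m - v n) by rewrite lt_def d0 psdnorm_ge0.
  rewrite -(ler_pM2r d0) -expr2.
  have := normcR (hnorm (v m - v n) ^+ 2).
  rewrite -inner_self innerBr ger0_norm ?sqr_ge0 // => <-.
  set d := v m - v n in Md d0 *.
  have -> : inner d (v m) - inner d (v n) =
            (l d - inner d (v n)) - (l d - inner d (v m)) by ring.
  apply: le_trans (normcD _ _) _; rewrite normcN.
  have := (vP n).2 _ Md; have := (vP m).2 _ Md; nra.
exists y.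
  apply: closed_hnorm => // d d0; have [|n] := @inv_small R (d / 2); first lra.
  rewrite -/(e n) => en; exists (v n); first exact: (vP n).1.
  by have := yv n; lra.
move=> w Mw; apply/eqP; rewrite -subr_eq0; apply/eqP.
apply: (@normc_small _ _ (3 * hnorm w)) => n; rewrite -/(e n).
have -> : l w - inner w y = (l w - inner w (v n)) - inner w (y - v n).
  by rewrite innerBr; ring.
apply: le_trans (normcD _ _) _; rewrite normcN.
have := inner_CauchySchwarz w (y - v n).
have := (vP n).2 _ Mw; have := ler_wpM2l (psdnorm_ge0 hp w) (yv n). lra.
Qed.

End HilbertSpaces.

(** * Bounded operators *)

Section BoundedOperatorTheory.
Context {R : realType} {H : hilbertType R}.
Implicit Types (a b : bop H) (x y z : H) (c : R[i]).
Local Notation normc := Normc.normc.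
Local Notation Re := complex.Re.

Lemma bopP a b : (forall x, a x = b x) -> a = b.
Proof. by move=> ab; apply/val_inj/funext. Qed.

Lemma bopDE a b x : (a + b) x = a x + b x. Proof. by []. Qed.
Lemma bopZE c a x : (c *: a) x = c *: a x. Proof. by []. Qed.
Lemma bopNE a x : (- a) x = - a x. Proof. by []. Qed.
Lemma bopBE a b x : (a - b) x = a x - b x. Proof. by []. Qed.
Lemma bopME a b x : (a * b) x = a (b x). Proof. by []. Qed.
Lemma bop1E x : (1 : bop H) x = x. Proof. by []. Qed.
Lemma bop0E x : (0 : bop H) x = 0. Proof. by []. Qed.
Definition bopE := (bopDE, bopNE, bopZE, bopME, bop1E, bop0E).

Lemma bop_sumE (I : Type) (r : seq I) (P : pred I) (F : I -> bop H) x :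
  (\sum_(i <- r | P i) F i) x = \sum_(i <- r | P i) F i x.
Proof. by apply: (big_morph (fun a : bop H => a x)). Qed.

Lemma bopL a c x y : a (c *: x + y) = c *: a x + a y.
Proof. by have /bounded_opP[/(_ c x y)] := bop_subproof a. Qed.

Lemma bopD a x y : a (x + y) = a x + a y.
Proof. by have := bopL a 1 x y; rewrite !scale1r. Qed.
Lemma bop0 a : a 0 = 0.
Proof. by have := bopD a 0 0; rewrite addr0 => /eqP; rewrite -subr_eq subrr => /eqP. Qed.
Lemma bopZ a c x : a (c *: x) = c *: a x.
Proof. by have := bopL a c x 0; rewrite bop0 !addr0. Qed.
Lemma bopN a x : a (- x) = - a x.
Proof. by rewrite -scaleN1r bopZ scaleN1r. Qed.
Lemma bopB a x y : a (x - y) = a x - a y.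
Proof. by rewrite bopD bopN. Qed.

Lemma mk_bop_subproof (f : H -> H) (C : R) :
  (forall c x y, f (c *: x + y) = c *: f x + f y) ->
  (forall x, hnorm (f x) <= C * hnorm x) -> f \in bounded_op.
Proof.
move=> fL fC; apply/bounded_opP; split=> //; exists C => x.
by rewrite !hnormE -rmorphM lecR.
Qed.

Lemma mk_bop (f : H -> H) (C : R) :
  (forall c x y, f (c *: x + y) = c *: f x + f y) ->
  (forall x, hnorm (f x) <= C * hnorm x) -> {a : bop H | forall x, a x = f x}.
Proof. by move=> fL fC; exists (Bop (mk_bop_subproof fL fC)). Qed.

Lemma opnorm_has_sup a : has_sup [set Re `|a x| | x in [set x : H | `|x| <= 1]].
Proof.
split; first by exists (Re `|a 0|), 0 => //=; rewrite normr0 ler01.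
have /bounded_opP[_ [M aM]] := bop_subproof a.
exists (Num.max M 0) => _ [x /= x1 <-].
have := aM x; move: x1; rewrite !hnormE -rmorphM !lecR /= => x1 aMx.
apply: le_trans aMx _; have := psdnorm_ge0 (hilbert_psd H) x.
by case: (leP M 0); nra.
Qed.

Lemma opnorm_ub a x : hnorm (a x) <= opnorm a * hnorm x.
Proof.
have [x0|x0] := eqVneq (hnorm x) 0.
  by rewrite (hnorm_eq0 x0) bop0 psdnorm0 mulr0.
have {}x0 : 0 < hnorm x by rewrite lt_def x0 psdnorm_ge0.
rewrite -ler_pdivrMr //; apply: ub_le_sup; first exact: (opnorm_has_sup a).2.
exists ((hnorm x)^-1%:C *: x) => /=.
  by rewrite hnormE psdnormZ normcR ger0_norm ?invr_ge0 ?(ltW x0) // mulVf ?gt_eqF.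
by rewrite hnormE bopZ psdnormZ normcR ger0_norm ?invr_ge0 ?(ltW x0) //= mulrC.
Qed.

Lemma opnorm_le a (C : R) :
  0 <= C -> (forall x, hnorm (a x) <= C * hnorm x) -> opnorm a <= C.
Proof.
move=> C0 aC; apply: ge_sup; first exact: (opnorm_has_sup a).1.
move=> _ [x /= x1 <-]; rewrite hnormE /=; move: x1; rewrite hnormE lecR => x1.
by apply: le_trans (aC x) _; rewrite ler_piMr.
Qed.

Lemma opnorm_ge0 a : 0 <= opnorm a.
Proof.
apply: ub_le_sup; first exact: (opnorm_has_sup a).2.
by exists 0; rewrite /= ?normr0 ?ler01 // bop0 normr0.
Qed.

Lemma opnormD a b : opnorm (a + b) <= opnorm a + opnorm b.
Proof.
apply: opnorm_le => [|x]; first by rewrite addr_ge0 ?opnorm_ge0.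
rewrite bopDE mulrDl; apply: le_trans (psdnormD _ _ _) _.
by rewrite lerD ?opnorm_ub.
Qed.

Lemma opnormM a b : opnorm (a * b) <= opnorm a * opnorm b.
Proof.
apply: opnorm_le => [|x]; first by rewrite mulr_ge0 ?opnorm_ge0.
rewrite bopME -mulrA; apply: le_trans (opnorm_ub _ _) _.
by rewrite ler_wpM2l ?opnorm_ge0 ?opnorm_ub.
Qed.

Lemma opnormZ_le c a : opnorm (c *: a) <= normc c * opnorm a.
Proof.
apply: opnorm_le => [|x]; first by rewrite mulr_ge0 ?opnorm_ge0 ?normc_ge0.
by rewrite bopZE psdnormZ -mulrA ler_wpM2l ?normc_ge0 ?opnorm_ub.
Qed.

Lemma opnormN a : opnorm (- a) = opnorm a.
Proof.
suff le b : opnorm (- b) <= opnorm b.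
  by apply/eqP; rewrite eq_le le -{1}[a]opprK le.
by apply: opnorm_le => [|x]; rewrite ?opnorm_ge0 // bopNE psdnormN opnorm_ub.
Qed.

Lemma opnorm_inner a x y : normc (inner (a x) y) <= opnorm a * hnorm x * hnorm y.
Proof.
apply: le_trans (inner_CauchySchwarz _ _) _.
by rewrite ler_wpM2r ?psdnorm_ge0 ?opnorm_ub.
Qed.

Lemma opnorm_le_inner a (C : R) : 0 <= C ->
  (forall x y, normc (inner (a x) y) <= C * hnorm x * hnorm y) -> opnorm a <= C.
Proof.
move=> C0 aC; apply: opnorm_le => // x.
have [a0|a0] := eqVneq (hnorm (a x)) 0; first by rewrite a0 mulr_ge0 ?psdnorm_ge0.
have {}a0 : 0 < hnorm (a x) by rewrite lt_def a0 psdnorm_ge0.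
have := aC x (a x); rewrite inner_self normcR ger0_norm ?sqr_ge0 //.
by rewrite expr2 ler_pM2r.
Qed.

Lemma adj_exists a : exists b, forall x y, inner (a x) y = inner x (b y).
Proof.
have /choice[f fP] y : exists z, forall x, inner (a x) y = inner x z.
  have [||x u v _ _|x _|z _ zP] := @riesz_on R H setT (fun x => inner (a x) y)
    (opnorm a * hnorm y).
  - by [].
  - exact: closedT.
  - by rewrite bopL innerDl innerZl.
  - by rewrite mulrAC opnorm_inner.
  by exists z => x; apply: zP.
have [||b bf] := @mk_bop f (opnorm a).
- move=> c x y; apply: inner_inj => w.
  by rewrite -fP !innerDr !innerZr !fP.
- move=> x; have [->|f0] := eqVneq (hnorm (f x)) 0.
    by rewrite mulr_ge0 ?psdnorm_ge0 ?opnorm_ge0.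
  have {}f0 : 0 < hnorm (f x) by rewrite lt_def f0 psdnorm_ge0.
  rewrite -(ler_pM2r f0) -expr2.
  have := normcR (hnorm (f x) ^+ 2); rewrite ger0_norm ?sqr_ge0 // => <-.
  by rewrite -inner_self -fP mulrAC opnorm_inner.
by exists b => x y; rewrite bf.
Qed.

Lemma adjP a x y : inner (a x) y = inner x (adj a y).
Proof.
rewrite /adj; case: xgetP => [b _ /(_ x y)//|no].
by have [b bP] := adj_exists a; have := no b bP.
Qed.

Lemma adjPr a x y : inner (adj a x) y = inner x (a y).
Proof. by rewrite innerC -adjP -innerC. Qed.

Lemma adj_unique a b : (forall x y, inner (a x) y = inner x (b y)) -> adj a = b.
Proof.
by move=> ab; apply: bopP => y; apply: inner_inj => x; rewrite -adjP ab.
Qed.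

Lemma adjK a : adj (adj a) = a.
Proof. by apply: adj_unique => x y; rewrite adjPr. Qed.

Lemma adjM a b : adj (a * b) = adj b * adj a.
Proof. by apply: adj_unique => x y; rewrite !bopE !adjP. Qed.

Lemma adjL c a b : adj (c *: a + b) = c^*%C *: adj a + adj b.
Proof.
apply: adj_unique => x y.
by rewrite !bopE innerDl innerZl innerDr innerZr conjcK !adjP.
Qed.

Lemma adjD a b : adj (a + b) = adj a + adj b.
Proof. by have := adjL 1 a b; rewrite conjc1 !scale1r. Qed.

Lemma adj0 : adj (0 : bop H) = 0.
Proof. by apply: adj_unique => x y; rewrite !bopE inner0l inner0r. Qed.

Lemma adjZ c a : adj (c *: a) = c^*%C *: adj a.
Proof. by have := adjL c a 0; rewrite adj0 !addr0. Qed.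

Lemma adjN a : adj (- a) = - adj a.
Proof. by rewrite -scaleN1r adjZ rmorphN rmorph1 scaleN1r. Qed.

Lemma adjB a b : adj (a - b) = adj a - adj b.
Proof. by rewrite adjD adjN. Qed.

Lemma adj1 : adj (1 : bop H) = 1.
Proof. by apply: adj_unique. Qed.

Lemma opnorm_adj a : opnorm (adj a) = opnorm a.
Proof.
suff le b : opnorm (adj b) <= opnorm b.
  by apply/eqP; rewrite eq_le le -{1}[a]adjK le.
apply: opnorm_le_inner => [|x y]; first exact: opnorm_ge0.
by rewrite adjPr innerC normcJ mulrAC opnorm_inner.
Qed.

Lemma inner_adj_self a x : inner ((adj a * a) x) x = (hnorm (a x) ^+ 2)%:C.
Proof. by rewrite bopME adjPr inner_self. Qed.

(** Polarization: the values at x + w and at i x + w recover <a x, w>, because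
    the scalars are complex. *)
Lemma bop_quadratic_eq0 a : (forall x, inner (a x) x = 0) -> a = 0.
Proof.
move=> a0; apply: bopP => x; rewrite bop0E; apply: inner_inj => w; rewrite inner0r.
rewrite innerC; apply/eqP; rewrite conjc_eq0; apply/eqP.
have := a0 (x + w); rewrite bopD !innerDl !innerDr !a0 addr0 add0r => e1.
have := a0 ('i%C *: x + w).
rewrite bopL !innerDl !innerDr !innerZl !innerZr !a0 !mulr0 addr0 add0r => e2.
have wx : inner (a w) x = - inner (a x) w by apply/eqP; rewrite -addr_eq0 addrC e1.
have : 'i%C * inner (a x) w *+ 2 = 0.
  move: e2; rewrite wx; set z := inner _ _; case: z => p q /= e2.
  rewrite -e2 mulr2n; apply/eqP; rewrite eq_complex /=.
  by apply/andP; split; apply/eqP; ring.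
move=> /eqP; rewrite mulrn_eq0 mulf_eq0 /= => /orP[|/eqP //].
by rewrite eq_complex /= oner_eq0 andbF.
Qed.

Lemma bop_scalerAr c a b : a * (c *: b) = c *: (a * b).
Proof. by apply: bopP => x; rewrite !bopE bopZ. Qed.

Lemma bop_scalerAl c a b : (c *: a) * b = c *: (a * b).
Proof. exact: bopP. Qed.

End BoundedOperatorTheory.

(** * Positive functionals and completely positive maps *)

Section LinearOn.
Context {R : realType} {V W : lmodType R[i]}.
Variables (T : set V) (f : V -> W).
Hypotheses (Tsub : subspace T) (fL : linear_on T f).

Lemma subspaceD u v : T u -> T v -> T (u + v).
Proof. by move=> Tu Tv; rewrite -[u]scale1r; exact: Tsub.2. Qed.
Lemma subspaceZ c u : T u -> T (c *: u).
Proof. by move=> Tu; rewrite -[_ *: u]addr0; apply: Tsub.2 => //; exact: Tsub.1. Qed.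
Lemma subspaceN u : T u -> T (- u).
Proof. by rewrite -scaleN1r; exact: subspaceZ. Qed.
Lemma subspaceB u v : T u -> T v -> T (u - v).
Proof. by move=> Tu /subspaceN; exact: subspaceD. Qed.
Lemma subspace_sum (I : Type) (r : seq I) (P : pred I) (F : I -> V) :
  (forall i, P i -> T (F i)) -> T (\sum_(i <- r | P i) F i).
Proof. by move=> TF; elim/big_ind: _ => //; [exact: Tsub.1 | exact: subspaceD]. Qed.

Lemma linear_onD u v : T u -> T v -> f (u + v) = f u + f v.
Proof. by move=> Tu Tv; have := fL 1 Tu Tv; rewrite !scale1r. Qed.
Lemma linear_on0 : f 0 = 0.
Proof.
have := linear_onD Tsub.1 Tsub.1; rewrite addr0 => /eqP.
by rewrite -subr_eq subrr => /eqP.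
Qed.
Lemma linear_onZ c u : T u -> f (c *: u) = c *: f u.
Proof. by move=> Tu; have := fL c Tu Tsub.1; rewrite linear_on0 !addr0. Qed.
Lemma linear_onN u : T u -> f (- u) = - f u.
Proof. by move=> Tu; rewrite -scaleN1r linear_onZ // scaleN1r. Qed.
Lemma linear_onB u v : T u -> T v -> f (u - v) = f u - f v.
Proof. by move=> Tu Tv; rewrite linear_onD ?linear_onN //; exact: subspaceN. Qed.
Lemma linear_on_sum (I : Type) (r : seq I) (F : I -> V) :
  (forall i, T (F i)) -> f (\sum_(i <- r) F i) = \sum_(i <- r) f (F i).
Proof.
move=> TF; elim: r => [|i r IH]; first by rewrite !big_nil linear_on0.
by rewrite !big_cons linear_onD ?IH //; exact: subspace_sum.
Qed.
End LinearOn.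

Definition positive_op (R : realType) (H : hilbertType R) (a : bop H) :=
  forall x, 0 <= inner (a x) x.

Definition positive_functional (R : realType) (H : hilbertType R)
    (T : set (bop H)) (f : bop H -> R[i]) :=
  linear_on T f /\ forall a, T a -> positive_op a -> 0 <= f a.

Section PositiveFunctionals.
Context {R : realType} {H : hilbertType R}.
Implicit Types (a b : bop H) (x y : H) (c : R[i]) (T : set (bop H)).
Local Notation normc := Normc.normc.
Local Notation Re := complex.Re.
Local Notation Im := complex.Im.

Lemma positive_adjM a : positive_op (adj a * a).
Proof. by move=> x; rewrite inner_adj_self ler0c sqr_ge0. Qed.

Lemma positive_op_inner a : adj a = a -> (forall x, 0 <= Re (inner (a x) x)) ->
  positive_op a.
Proof.
move=> aa a0 x; apply/complex_ge0P; split=> //.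
have : inner (a x) x = (inner (a x) x)^*%C by rewrite -innerC -{2}aa -adjP.
by move/(congr1 (@complex.Im R)); rewrite cImJ => ?; lra.
Qed.

Lemma cp_positive (L : hilbertType R) T (Phi : bop H -> bop L) a :
  completely_positive T Phi -> T a -> positive_op a -> positive_op (Phi a).
Proof.
move=> [_ cp] Ta a0 x.
have /(_ (fun=> x)) : mxpos 1 (map_mx Phi (const_mx a)).
  by apply: cp => [i j|y]; rewrite ?big_ord1 mxE.
by rewrite !big_ord1 !mxE.
Qed.

(** The quadratic form of (f a_ij) at x is the value of f at the operator
    sum_ij conj(x_i) x_j a_ij, which is positive when the matrix (a_ij) is. *)
Lemma cp_functionalP T (f : bop H -> R[i]) : subspace T ->
  completely_positive T f <-> positive_functional T f.
Proof.
move=> Tsub; split=> [[fL cp]|[fL f0]]; split=> //.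
  move=> a Ta a0; have /(_ (fun=> 1)) : mxpos 1 (map_mx f (const_mx a)).
    by apply: cp => [i j|y]; rewrite ?big_ord1 mxE.
  by rewrite !big_ord1 !mxE mulr1 rmorph1 mulr1.
move=> n A TA A0 x.
have TcA i j : T ((x j * (x i)^*%C) *: A i j) by apply: subspaceZ.
have -> : \sum_i \sum_j map_mx f A i j * x j * (x i)^*%R =
    f (\sum_i \sum_j (x j * (x i)^*%C) *: A i j).
  rewrite (linear_on_sum Tsub fL) => [|i]; last exact: subspace_sum.
  apply: eq_bigr => i _; rewrite (linear_on_sum Tsub fL) //; apply: eq_bigr => j _.
  by rewrite (linear_onZ Tsub fL _ (TA i j)) mxE -mulrA mulrC.
apply: f0 => [|y].
  by apply: subspace_sum => // i _; exact: subspace_sum.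
have := A0 (fun i => x i *: y); congr (_ <= _).
rewrite bop_sumE inner_suml.
apply: eq_bigr => i _.
rewrite bop_sumE inner_suml.
by apply: eq_bigr => j _; rewrite bopZE innerZl bopZ innerZl innerZr mulrA.
Qed.

Section Functional.
Variables (T : set (bop H)) (f : bop H -> R[i]).
Hypotheses (Tsys : operator_system T) (fP : positive_functional T f).

Let Tsub : subspace T. Proof. by case: Tsys. Qed.
Let T1 : T 1. Proof. by case: Tsys. Qed.
Let Tadj a : T a -> T (adj a). Proof. by case: Tsys => _ _; exact. Qed.
Let fL : linear_on T f. Proof. by case: fP. Qed.

Lemma functional1_ge0 : 0 <= f 1.
Proof. by apply: fP.2 => // x; rewrite bop1E inner_self ler0c sqr_ge0. Qed.

Let f1_Re : f 1 = (Re (f 1))%:C.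
Proof. by have /complex_ge0P[_] := functional1_ge0; case: (f 1) => p q /= ->. Qed.

Let f_sa_Im a : T a -> adj a = a -> Im (f a) = 0.
Proof.
move=> Ta aa; have TM := subspaceZ Tsub (opnorm a)%:C T1.
have T' := subspaceB Tsub TM Ta.
have /complex_ge0P[_] : 0 <= f ((opnorm a)%:C *: (1 : bop H) - a).
  apply: fP.2 => //; apply: positive_op_inner => [|x].
    by rewrite adjB adjZ adj1 conjc_real aa.
  rewrite bopE innerDl innerNl innerZl inner_self cReD cReZ cReN /=.
  have := le_trans (Re_le_normc _) (opnorm_inner a x x).
  by rewrite ler_norml expr2; lra.
rewrite (linear_onB Tsub fL TM Ta) (linear_onZ Tsub fL _ T1) f1_Re.
by case: (f a) => p q /= ?; lra.
Qed.

(** A self-adjoint a has a real value, because |a| 1 - a is positive and f 1 is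
    real; apply this to a + a^* and to i (a - a^* ). *)
Lemma functional_adj a : T a -> f (adj a) = (f a)^*%C.
Proof.
move=> Ta; have Ta' := Tadj Ta; have Tb := subspaceB Tsub Ta Ta'.
apply: eq_ReIm; rewrite ?cReJ ?cImJ.
  have : Im (f ('i%C *: (a - adj a))) = 0.
    apply: f_sa_Im; first exact: subspaceZ.
    by rewrite adjZ adjB adjK -[a - adj a]opprB scalerN -scaleNr; congr (_ *: _); apply/eqP;
       rewrite eq_complex /= oppr0 !eqxx.
  rewrite (linear_onZ Tsub fL _ Tb) (linear_onB Tsub fL Ta Ta').
  by rewrite [_ *: _]/(_ * _); case: (f a) (f (adj a)) => p q [r s] /=; lra.
have : Im (f (a + adj a)) = 0.
  by apply: f_sa_Im; [exact: subspaceD | rewrite adjD adjK addrC].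
by rewrite (linear_onD fL Ta Ta'); case: (f a) (f (adj a)) => p q [r s] /=; lra.
Qed.

Lemma functional_Re_ge0 a : T a -> (forall x, 0 <= Re (inner (a x) x)) ->
  0 <= Re (f a).
Proof.
move=> Ta a0; have Ta' := Tadj Ta.
have /complex_ge0P[+ _] : 0 <= f (a + adj a).
  apply: fP.2; first exact: subspaceD.
  apply: positive_op_inner => [|x]; first by rewrite adjD adjK addrC.
  by rewrite bopDE innerDl adjPr [inner x _]innerC cReD cReJ addr_ge0.
by rewrite (linear_onD fL Ta Ta') functional_adj // cReD cReJ; lra.
Qed.

Lemma functional_Re_le a (M : R) : T a ->
  (forall x, Re (inner (a x) x) <= M * hnorm x ^+ 2) -> Re (f a) <= M * Re (f 1).
Proof.
move=> Ta aM; have TM := subspaceZ Tsub M%:C T1.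
have T' := subspaceB Tsub TM Ta.
have := functional_Re_ge0 T'.
rewrite (linear_onB Tsub fL TM Ta) (linear_onZ Tsub fL _ T1).
rewrite [_ *: f 1]/(_ * f 1) cReD cReN cReZ subr_ge0; apply=> x.
by rewrite bopE innerDl innerNl innerZl inner_self cReD cReZ cReN /= subr_ge0.
Qed.

Lemma functional_bounded a : T a -> normc (f a) <= 2 * (opnorm a * Re (f 1)).
Proof.
move=> Ta; have bd b : T b -> opnorm b <= opnorm a -> Re (f b) <= opnorm a * Re (f 1).
  move=> Tb ba; apply: functional_Re_le => // x.
  have := le_trans (Re_le_normc _) (opnorm_inner b x x).
  rewrite ler_norml -mulrA -expr2 => /andP[_] /le_trans; apply.
  by rewrite ler_wpM2r ?sqr_ge0.
have ia s : normc s = 1 -> Re (s * f a) <= opnorm a * Re (f 1).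
  move=> s1; have -> : s * f a = f (s *: a) by rewrite (linear_onZ Tsub fL s Ta).
  apply: bd; first exact: subspaceZ.
  by rewrite -[leRHS]mul1r -s1 opnormZ_le.
have i1 : normc ('i%C : R[i]) = 1 by rewrite /= expr0n expr1n add0r sqrtr1.
have n1 : normc (-1 : R[i]) = 1 by rewrite normcN Normc.normc1.
have := ia 1 (Normc.normc1 _); have := ia (-1) n1.
have := ia 'i%C i1; have := ia (- 'i%C); rewrite normcN => /(_ i1).
move: (opnorm a * _) => M r1 r2 r3 r4.
apply: le_trans (normc_le_ReIm (f a)) _; move: r1 r2 r3 r4.
case: (f a) => p q /= r1 r2 r3 r4.
have : `|p| <= M by rewrite ler_norml; lra.
have : `|q| <= M by rewrite ler_norml; lra.
lra.
Qed.
End Functional.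
End PositiveFunctionals.

(** * Sublinear functionals *)

Section Sublinear.
Context {R : realType} {V : lmodType R[i]}.
Implicit Types (p q g : V -> R) (x y : V) (t s : R).

Definition sublinear q :=
  (forall x y, q (x + y) <= q x + q y) /\
  (forall t x, 0 <= t -> q (t%:C *: x) <= t * q x).

Definition real_linear g :=
  (forall x y, g (x + y) = g x + g y) /\ (forall t x, g (t%:C *: x) = t * g x).

(** The linear functionals below q form a face of those below p. Scaling the
    bounds of the two parts by t and 1 - t, instead of dividing the parts by
    these weights, includes the degenerate weights 0 and 1. *)
Definition facial p q := forall g1 g2 t,
  real_linear g1 -> real_linear g2 -> 0 <= t <= 1 ->
  (forall x, g1 x <= t * p x) -> (forall x, g2 x <= (1 - t) * p x) ->
  (forall x, g1 x + g2 x <= q x) ->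
  (forall x, g1 x <= t * q x) /\ (forall x, g2 x <= (1 - t) * q x).

Lemma le_mul_inf (E : set R) (a t : R) : has_inf E -> 0 <= t ->
  (forall b, E b -> a <= t * b) -> a <= t * inf E.
Proof.
move=> Einf; rewrite le_eqVlt => /predU1P[<- aE|t0 aE].
  by have [[b /aE]] := Einf; rewrite !mul0r.
rewrite -ler_pdivrMl //; apply: lb_le_inf; first exact: Einf.1.
by move=> b /aE; rewrite ler_pdivrMl.
Qed.

Lemma real_linearN g x : real_linear g -> g (- x) = - g x.
Proof. by move=> [_ gZ]; rewrite -scaleN1r -(rmorphN1 (real_complex R)) gZ mulN1r. Qed.

Lemma sublinear0 q : sublinear q -> q 0 = 0.
Proof.
move=> [qD qZ]; apply/eqP; rewrite eq_le; apply/andP; split.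
  by have := qZ 0 0 (lexx 0); rewrite scaler0 mul0r.
by have := qD 0 0; rewrite addr0; lra.
Qed.

Lemma sublinearZ q t x : sublinear q -> 0 <= t -> q (t%:C *: x) = t * q x.
Proof.
move=> qS; rewrite le_eqVlt => /predU1P[<-|t0].
  by rewrite scale0r mul0r sublinear0.
apply/eqP; rewrite eq_le qS.2 ?(ltW t0) //= -ler_pdivlMl //.
have := qS.2 t^-1 (t%:C *: x); rewrite invr_ge0 (ltW t0) => /(_ isT).
by rewrite scalerA -rmorphM /= mulVf ?gt_eqF // scale1r.
Qed.

Lemma sublinearN q x : sublinear q -> - q (- x) <= q x.
Proof.
by move=> qS; have := qS.1 x (- x); rewrite subrr sublinear0 //; lra.
Qed.

(** The values at x of q recentred so as to force the value q x0 at x0: the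
    linear functionals below [push q x0] are those below q that agree with q at
    x0. *)
Definition push_values q x0 x := [set q (x + s%:C *: x0) - s * q x0 | s in [set s | 0 <= s]].
Definition push q x0 x := inf (push_values q x0 x).

Section Push.
Variables (q : V -> R) (x0 : V).
Hypothesis qS : sublinear q.

Lemma push_values_inf x : has_inf (push_values q x0 x).
Proof.
split; first by exists (q (x + 0%:C *: x0) - 0 * q x0), 0; rewrite /= ?lexx.
exists (- q (- x)) => _ [s /= s0 <-].
have := qS.1 (x + s%:C *: x0) (- x).
by rewrite [_ - x]addrC addKr sublinearZ //; lra.
Qed.

Lemma push_le_at x s : 0 <= s -> push q x0 x <= q (x + s%:C *: x0) - s * q x0.
Proof. by move=> s0; apply: ge_inf; [exact: (push_values_inf x).2 | exists s]. Qed.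

Lemma push_le x : push q x0 x <= q x.
Proof. by have := push_le_at x (lexx 0); rewrite scale0r addr0 mul0r subr0. Qed.

Lemma push_opp : push q x0 (- x0) <= - q x0.
Proof.
have := push_le_at (- x0) ler01.
by rewrite scale1r addNr sublinear0 // mul1r sub0r.
Qed.

Lemma push_sublinear : sublinear (push q x0).
Proof.
split=> [x y|t x t0].
  rewrite -lerBlDr -[leRHS]mul1r; apply: le_mul_inf => //.
    exact: push_values_inf.
  move=> _ [s /= s0 <-]; rewrite mul1r lerBlDr -lerBlDl -[leRHS]mul1r.
  apply: le_mul_inf => //; first exact: push_values_inf.
  move=> _ [s' /= s'0 <-]; rewrite mul1r lerBlDl.
  apply: le_trans (push_le_at _ (addr_ge0 s0 s'0)) _.
  rewrite rmorphD scalerDl addrACA.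
  by have := qS.1 (x + s%:C *: x0) (y + s'%:C *: x0); lra.
apply: le_mul_inf => //; first exact: push_values_inf.
move=> _ [s /= s0 <-]; apply: le_trans (push_le_at _ (mulr_ge0 t0 s0)) _.
rewrite rmorphM -scalerA -scalerDr mulrBr -mulrA lerD2r.
exact: qS.2.
Qed.

(** If g1 + g2 is below the push, then g1 x0 + g2 x0 >= q x0, so the bounds of
    both parts at x0 are attained, and translating along x0 loses nothing. *)
Lemma push_facial p : facial p q -> facial p (push q x0).
Proof.
move=> qF g1 g2 t g1L g2L t01 g1p g2p g12.
have [g1q g2q] : (forall x, g1 x <= t * q x) /\ (forall x, g2 x <= (1 - t) * q x).
  by apply: qF => // x; exact: le_trans (g12 x) (push_le x).
have /andP[t0 t1] := t01.
have := le_trans (g12 (- x0)) push_opp; rewrite !real_linearN // => ge.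
have e1 : g1 x0 = t * q x0.
  by apply/eqP; rewrite eq_le g1q /=; have := g2q x0; lra.
have e2 : g2 x0 = (1 - t) * q x0.
  by apply/eqP; rewrite eq_le g2q /=; have := g1q x0; lra.
split=> x; apply: le_mul_inf; rewrite ?subr_ge0 //; try exact: push_values_inf.
  move=> _ [s /= s0 <-]; have := g1q (x + s%:C *: x0).
  by rewrite g1L.1 g1L.2 e1; lra.
move=> _ [s /= s0 <-]; have := g2q (x + s%:C *: x0).
by rewrite g2L.1 g2L.2 e2; lra.
Qed.

End Push.

Section ChainInf.
Variables (A : set (V -> R)) (p q0 : V -> R).
Hypotheses (A0 : A q0) (AS : forall q, A q -> sublinear q)
  (Ap : forall q, A q -> forall x, q x <= p x)
  (Atot : forall q r, A q -> A r -> (forall x, q x <= r x) \/ (forall x, r x <= q x)).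

Definition chain_inf x := inf [set q x | q in A].

Lemma chain_has_inf x : has_inf [set q x | q in A].
Proof.
split; first by exists (q0 x), q0.
exists (- p (- x)) => _ [q Aq <-].
by have := sublinearN x (AS Aq); have := Ap Aq (- x); lra.
Qed.

Lemma chain_inf_le q x : A q -> chain_inf x <= q x.
Proof. by move=> Aq; apply: ge_inf; [exact: (chain_has_inf x).2 | exists q]. Qed.

(** Of two members of the chain the smaller one witnesses subadditivity. *)
Lemma chain_inf_sublinear : sublinear chain_inf.
Proof.
split=> [x y|t x t0].
  rewrite -lerBlDr -[leRHS]mul1r; apply: le_mul_inf => //.
    exact: chain_has_inf.
  move=> _ [q Aq <-]; rewrite mul1r lerBlDr -lerBlDl -[leRHS]mul1r.
  apply: le_mul_inf => //; first exact: chain_has_inf.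
  move=> _ [r Ar <-]; rewrite mul1r lerBlDl.
  have [qr|rq] := Atot Aq Ar.
    have := chain_inf_le (x + y) Aq; have := (AS Aq).1 x y.
    by have := qr y; lra.
  have := chain_inf_le (x + y) Ar; have := (AS Ar).1 x y.
  by have := rq x; lra.
apply: le_mul_inf => //; first exact: chain_has_inf.
move=> _ [q Aq <-]; apply: le_trans (chain_inf_le _ Aq) _.
exact: (AS Aq).2.
Qed.

Lemma chain_inf_facial P : (forall q, A q -> facial P q) -> facial P chain_inf.
Proof.
move=> AF g1 g2 t g1L g2L t01 g1p g2p g12.
have g12q q : A q ->
    (forall x, g1 x <= t * q x) /\ (forall x, g2 x <= (1 - t) * q x).
  by move=> Aq; apply: AF => // x; exact: le_trans (g12 x) (chain_inf_le x Aq).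
have /andP[t0 t1] := t01.
split=> x; apply: le_mul_inf; rewrite ?subr_ge0 //; try exact: chain_has_inf.
  by move=> _ [q Aq <-]; exact: (g12q q Aq).1.
by move=> _ [q Aq <-]; exact: (g12q q Aq).2.
Qed.

End ChainInf.

(** A minimal facial sublinear functional q is linear, since it cannot be
    lowered by any push; being facial, it is then an extreme point. This
    contains both the Hahn-Banach and the Krein-Milman theorems in the form
    needed below, and no topology enters. *)
Lemma extreme_functional p x0 : sublinear p ->
  exists g, [/\ real_linear g, forall x, g x <= p x, g x0 = p x0 & facial p g].
Proof.
move=> pS; pose P q := [/\ sublinear q, facial p q & forall x, q x <= push p x0 x].
have P0 : P (push p x0).
  split=> //; first exact: push_sublinear.
  by apply: push_facial => // g1 g2 t _ _ _.
pose T := {q | P q}; pose ge (q r : T) := `[< forall x, sval r x <= sval q x >].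
have [||||[q [qS qF qp]] qmin] := @Zorn T ge.
- by move=> q; apply/asboolP.
- by move=> q r s /asboolP qr /asboolP rs; apply/asboolP => x; exact: le_trans (rs x) (qr x).
- move=> [q Pq] [r Pr] /asboolP /= qr /asboolP /= rq; apply/eq_exist/funext => x.
  by apply/eqP; rewrite eq_le qr rq.
- move=> A Atot; have [->|/set0P[[q0 Pq0] Aq0]] := eqVneq A set0.
    by exists (exist _ _ P0).
  pose B := [set sval r | r in A].
  have B0 : B q0 by exists (exist _ _ Pq0).
  have BS q : B q -> sublinear q by move=> [[? [? ? ?]] _ <-].
  have BF q : B q -> facial p q by move=> [[? [? ? ?]] _ <-].
  have Bp q : B q -> forall x, q x <= push p x0 x by move=> [[? [? ? ?]] _ <-].
  have Btot q r : B q -> B r -> (forall x, q x <= r x) \/ (forall x, r x <= q x).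
    by move=> [q' Aq <-] [r' Ar <-]; have [/asboolP|/asboolP] := Atot _ _ Aq Ar; [right|left].
  have PB : P (chain_inf B).
    split; first exact: (chain_inf_sublinear B0 BS Bp).
      exact: (chain_inf_facial B0 BS Bp).
    by move=> x; apply: le_trans (chain_inf_le B0 BS Bp x B0) (Bp _ B0 x).
  exists (exist _ _ PB) => r Ar; apply/asboolP => x /=.
  by apply: (chain_inf_le B0 BS Bp); exists r.
(* Pushing q along x stays in the class, so by minimality it changes nothing. *)
have q_push x : q (- x) <= - q x.
  have Pq : P (push q x).
    split; [exact: push_sublinear | exact: push_facial |] => y.
    exact: le_trans (push_le x qS y) (qp y).
  have /(congr1 sval) /= e := qmin (exist _ _ Pq) (introT (asboolP _) (push_le x qS)).
  by have := push_opp x qS; rewrite e.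
have qN x : q (- x) = - q x.
  by apply/eqP; rewrite eq_le q_push /=; have := sublinearN (- x) qS; rewrite opprK; lra.
have qD x y : q (x + y) = q x + q y.
  apply/eqP; rewrite eq_le qS.1 /=.
  by have := qS.1 (- x) (- y); rewrite -opprD !qN; lra.
exists q; split=> //.
- split=> // t x; case: (lerP 0 t) => [t0|t0]; first exact: sublinearZ.
  rewrite -[t]opprK rmorphN scaleNr qN sublinearZ ?mulNr //.
  by rewrite oppr_ge0 ltW.
- by move=> x; exact: le_trans (qp x) (push_le x0 pS x).
- apply/eqP; rewrite eq_le; apply/andP; split.
    exact: le_trans (qp x0) (push_le x0 pS x0).
  by have := le_trans (qp (- x0)) (push_opp x0 pS); rewrite qN; lra.
Qed.

End Sublinear.

(** * Extension of positive functionals and existence of pure states *)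

(** Bundling a subspace with its closure proof lets its elements inherit a
    vector space structure. *)
Record vsubspace (R : realType) (V : lmodType R[i]) := VSubspace {
  vsub_set :> set V ;
  vsub_subspace : subspace vsub_set }.

Definition vsub_pred (R : realType) (V : lmodType R[i]) (T : vsubspace V) :
  {pred V} := mem (vsub_set T).

Lemma vsub_pred_closed (R : realType) (V : lmodType R[i]) (T : vsubspace V) :
  subsemimod_closed (vsub_pred T).
Proof.
have Tsub := vsub_subspace T.
split; [split|]; rewrite ?inE; first exact: Tsub.1.
  by move=> u v; rewrite !inE; exact: subspaceD.
by move=> c u; rewrite !inE; exact: subspaceZ.
Qed.

HB.instance Definition _ (R : realType) (V : lmodType R[i]) (T : vsubspace V) :=
  GRing.isSubmodClosed.Build R[i] V (vsub_pred T) (vsub_pred_closed T).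

Record subvect (R : realType) (V : lmodType R[i]) (T : vsubspace V) := SubVect {
  subvect_val :> V ;
  subvect_subproof : subvect_val \in vsub_pred T }.

HB.instance Definition _ (R : realType) (V : lmodType R[i]) (T : vsubspace V) :=
  [isSub for @subvect_val R V T].
HB.instance Definition _ (R : realType) (V : lmodType R[i]) (T : vsubspace V) :=
  [Choice of subvect T by <:].
HB.instance Definition _ (R : realType) (V : lmodType R[i]) (T : vsubspace V) :=
  [SubChoice_isSubLmodule of subvect T by <:].

Lemma subvectP (R : realType) (V : lmodType R[i]) (T : vsubspace V) (u : subvect T) :
  vsub_set T u.
Proof. by have := subvect_subproof u; rewrite inE. Qed.

Lemma subvect_ex (R : realType) (V : lmodType R[i]) (T : vsubspace V) (v : V) :
  vsub_set T v -> {u : subvect T | u = v :> V}.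
Proof. by move=> Tv; exists (SubVect (mem_set Tv)). Qed.

Section Complexify.
Context {R : realType} {V : lmodType R[i]}.
Local Notation Re := complex.Re.

Definition complexify (g : V -> R) (x : V) : R[i] := g x +i* - g ('i%C *: x).

Lemma complexifyL (g : V -> R) c u v : real_linear g ->
  complexify g (c *: u + v) = c * complexify g u + complexify g v.
Proof.
move=> [gD gZ]; case: c => a b.
have ab : a +i* b = a%:C + b%:C * 'i%C :> R[i].
  by apply/eqP; rewrite eq_complex /=; apply/andP; split; apply/eqP; ring.
have ii : 'i%C * (a +i* b) = a%:C * 'i%C + (- b)%:C :> R[i].
  by apply/eqP; rewrite eq_complex /=; apply/andP; split; apply/eqP; ring.
rewrite /complexify scalerDr scalerA ii ab !scalerDl -!scalerA !gD !gZ -ab.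
by apply/eqP; rewrite eq_complex /=; apply/andP; split; apply/eqP; ring.
Qed.

(** The imaginary part of a linear functional at a is minus its real part at
    i a. *)
Lemma linear_on_Re_inj (T : set V) (f g : V -> R[i]) :
  subspace T -> linear_on T (f : V -> R[i]^o) -> linear_on T (g : V -> R[i]^o) ->
  (forall a, T a -> Re (f a) = Re (g a)) -> forall a, T a -> f a = g a.
Proof.
move=> Tsub fL gL fg a Ta; apply: eq_ReIm; first exact: fg.
have := fg _ (subspaceZ Tsub 'i%C Ta).
rewrite (linear_onZ Tsub fL _ Ta) (linear_onZ Tsub gL _ Ta).
by case: (f a) (g a) => [p q] [r s] /=; lra.
Qed.

End Complexify.

Section Extension.
Context {R : realType} {H : hilbertType R}.
Local Notation Re := complex.Re.
Variables (D : set (bop H)) (g : bop H -> R[i]).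
Hypotheses (Dsys : operator_system D) (gP : positive_functional D g).

Let Dsub : subspace D. Proof. by case: Dsys. Qed.
Let D1 : D 1. Proof. by case: Dsys. Qed.
Let gL : linear_on D g. Proof. exact: gP.1. Qed.

Definition dominating (x : bop H) :=
  [set y | D y /\ forall z, Re (inner (x z) z) <= Re (inner (y z) z)].
Definition dominating_inf x := inf [set Re (g y) | y in dominating x].

Lemma Re_inner_opnorm (x : bop H) z : Re (inner (x z) z) <= opnorm x * hnorm z ^+ 2.
Proof.
have := le_trans (Re_le_normc _) (opnorm_inner x z z).
by rewrite ler_norml -mulrA -expr2 => /andP[].
Qed.

Lemma inner_scalar (M : R) z :
  inner ((M%:C *: (1 : bop H)) z) z = (M * hnorm z ^+ 2)%:C.
Proof. by rewrite !bopE innerZl inner_self -rmorphM. Qed.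

Lemma dominating_has_inf x : has_inf [set Re (g y) | y in dominating x].
Proof.
split.
  exists (Re (g ((opnorm x)%:C *: (1 : bop H)))), ((opnorm x)%:C *: (1 : bop H)) => //.
  split=> [|z]; first exact: (subspaceZ Dsub).
  by rewrite inner_scalar; exact: Re_inner_opnorm.
exists (- (opnorm x * Re (g 1))) => _ [y [Dy xy] <-].
rewrite lerNl -cReN -(linear_onN Dsub gL Dy).
apply: (functional_Re_le Dsys gP); first exact: (subspaceN Dsub).
move=> z; rewrite bopNE innerNl cReN.
have := xy z; have := Re_inner_opnorm (- x) z.
by rewrite opnormN bopNE innerNl cReN; lra.
Qed.

Lemma dominating_inf_le x y : dominating x y -> dominating_inf x <= Re (g y).
Proof. by move=> xy; apply: ge_inf; [exact: (dominating_has_inf x).2 | exists y]. Qed.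

Lemma dominating_sublinear : sublinear dominating_inf.
Proof.
split=> [x y|t x t0].
  rewrite -lerBlDr -[leRHS]mul1r; apply: le_mul_inf => //.
    exact: dominating_has_inf.
  move=> _ [x' [Dx' xx'] <-]; rewrite mul1r lerBlDr -lerBlDl -[leRHS]mul1r.
  apply: le_mul_inf => //; first exact: dominating_has_inf.
  move=> _ [y' [Dy' yy'] <-]; rewrite mul1r lerBlDl -cReD -(linear_onD gL Dx' Dy').
  apply: dominating_inf_le; split=> [|z]; first exact: (subspaceD Dsub).
  by rewrite !bopDE !innerDl !cReD lerD.
apply: le_mul_inf => //; first exact: dominating_has_inf.
move=> _ [y [Dy xy] <-]; rewrite -cReZ.
have -> : t%:C * g y = g (t%:C *: y) by rewrite (linear_onZ Dsub gL _ Dy).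
apply: dominating_inf_le; split=> [|z]; first exact: (subspaceZ Dsub).
by rewrite !bopZE !innerZl !cReZ ler_wpM2l.
Qed.

(** A real linear functional below x |-> inf {Re g y | y in D, x <= y} is
    positive, and agrees with Re g on D. *)
Lemma positive_extension :
  exists2 G, positive_functional setT G & forall a, D a -> G a = g a.
Proof.
have [f [fL fp _ _]] := extreme_functional 0 dominating_sublinear.
(* An operator with nonpositive quadratic form is dominated by 0. *)
have f_le0 (x : bop H) : (forall z, Re (inner (x z) z) <= 0) -> f x <= 0.
  move=> x0; apply: le_trans (fp x) _.
  rewrite -[leRHS]/(Re (0 : R[i])) -(linear_on0 Dsub gL).
  apply: dominating_inf_le; split=> [|z]; first exact: Dsub.1.
  by rewrite bop0E inner0l.
have GL c (u v : bop H) : complexify f (c *: u + v) = c * complexify f u + complexify f v.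
  exact: complexifyL.
exists (complexify f).
  split=> [c u v _ _|a _ a0]; first exact: GL.
  apply/complex_ge0P; split=> /=.
    rewrite -oppr_le0 -real_linearN //; apply: f_le0 => z.
    by rewrite bopNE innerNl cReN oppr_le0; have /complex_ge0P[] := a0 z.
  apply/eqP; rewrite oppr_eq0 eq_le; apply/andP; split.
    apply: f_le0 => z; rewrite bopZE innerZl.
    by have /complex_ge0P[] := a0 z; case: (inner _ _) => p q /= _ ->; lra.
  rewrite -oppr_le0 -real_linearN //; apply: f_le0 => z.
  rewrite bopNE bopZE innerNl innerZl.
  by have /complex_ge0P[] := a0 z; case: (inner _ _) => p q /= _ ->; lra.
apply: (linear_on_Re_inj Dsub) => // a Da /=.
have le (b : bop H) : D b -> f b <= Re (g b).
  by move=> Db; apply: le_trans (fp b) _; exact: dominating_inf_le.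
apply/eqP; rewrite eq_le le //=.
have := le _ (subspaceN Dsub Da).
by rewrite (linear_onN Dsub gL Da) cReN real_linearN //; lra.
Qed.

End Extension.

Section PureStates.
Context {R : realType} {H : hilbertType R}.
Local Notation Re := complex.Re.
Variables (T : set (bop H)) (Tsys : operator_system T).

Let Tsub : subspace T. Proof. by case: Tsys. Qed.
Let T1 : T 1. Proof. by case: Tsys. Qed.
Let S := VSubspace Tsub.
Local Notation op u := (subvect_val u : bop H).

Definition numerical_bounds (a : bop H) :=
  [set M : R | forall z, Re (inner (a z) z) <= M * hnorm z ^+ 2].

(** The supremum of the numerical range. *)
Definition numerical_sup (a : bop H) := inf (numerical_bounds a).

Section NumericalSup.
Variables (z0 : H) (z0_neq0 : z0 != 0).

Lemma numerical_bounds_inf (a : bop H) : has_inf (numerical_bounds a).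
Proof.
split; first by exists (opnorm a) => z; exact: Re_inner_opnorm.
exists (- opnorm a) => M aM; have := aM z0; have := Re_inner_opnorm (- a) z0.
rewrite opnormN bopNE innerNl cReN.
have : 0 < hnorm z0.
  rewrite lt_def psdnorm_ge0 andbT; apply: contra z0_neq0 => /eqP z0n.
  by rewrite (hnorm_eq0 z0n).
by move=> /(exprn_gt0 2) z0_gt0 h1 h2; rewrite -(ler_pM2r z0_gt0) mulNr; lra.
Qed.

Lemma numerical_sup_le (a : bop H) M : numerical_bounds a M -> numerical_sup a <= M.
Proof. by move=> aM; apply: ge_inf; [exact: (numerical_bounds_inf a).2|]. Qed.

Lemma numerical_sup_bound (a : bop H) z :
  Re (inner (a z) z) <= numerical_sup a * hnorm z ^+ 2.
Proof.
rewrite mulrC; apply: le_mul_inf; rewrite ?sqr_ge0 //; first exact: numerical_bounds_inf.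
by move=> M aM; rewrite mulrC; exact: aM.
Qed.

Lemma numerical_sup_sublinear :
  sublinear (fun u : subvect S => numerical_sup (op u)).
Proof.
split=> [u v|t u t0]; apply: numerical_sup_le => z.
  rewrite bopDE innerDl cReD mulrDl; apply: lerD; exact: numerical_sup_bound.
rewrite bopZE innerZl cReZ -mulrA ler_wpM2l //; exact: numerical_sup_bound.
Qed.

(** Linear functionals below the supremum of the numerical range are the real
    parts of states. A positive part G of such a state f lies below G 1 times
    that supremum; as g is facial, Re G <= G 1 Re f, and linearity turns this
    into an equality. *)
Lemma extreme_pure_state (g : subvect S -> R) :
  real_linear g -> (forall u, g u <= numerical_sup (op u)) ->
  facial (fun u : subvect S => numerical_sup (op u)) g ->
  exists2 f, pure_state T f & forall u : subvect S, Re (f (op u)) = g u.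
Proof.
move=> gL g_le gF.
have g_le0 (u : subvect S) : (forall z, Re (inner (op u z) z) <= 0) -> g u <= 0.
  move=> u0; apply: le_trans (g_le u) _; apply: numerical_sup_le => z.
  by rewrite mul0r.
have gL' c (u v : subvect S) :
    complexify g (c *: u + v) = c * complexify g u + complexify g v.
  exact: complexifyL.
pose f (a : bop H) : R[i] :=
  if pselect (T a) is left Ta then complexify g (SubVect (mem_set Ta : a \in vsub_pred S))
  else 0.
have fE (u : subvect S) : f (op u) = complexify g u.
  rewrite /f; case: pselect => [Tu|[]]; last exact: (subvectP u).
  by congr complexify; exact: val_inj.
have fL : linear_on T (f : bop H -> R[i]^o).
  move=> c a b Ta Tb; have [u <-] := subvect_ex (Ta : vsub_set S a).
  have [v <-] := subvect_ex (Tb : vsub_set S b).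
  by rewrite -[_ + _]/(subvect_val (c *: u + v)) !fE gL'.
have f_pos : positive_functional T f.
  split=> // a Ta a0; have [u ua] := subvect_ex (Ta : vsub_set S a).
  rewrite -{}ua fE in a0 *; apply/complex_ge0P; split=> /=.
    rewrite -oppr_le0 -real_linearN //; apply: g_le0 => z.
    rewrite -[subvect_val _]/(- (op u)) bopNE innerNl cReN oppr_le0.
    by have /complex_ge0P[] := a0 z.
  apply/eqP; rewrite oppr_eq0 eq_le; apply/andP; split.
    apply: g_le0 => z; rewrite -[subvect_val _]/('i%C *: (op u)) bopZE innerZl.
    by have /complex_ge0P[] := a0 z; case: (inner _ _) => p q /= _ ->; lra.
  rewrite -oppr_le0 -real_linearN //; apply: g_le0 => z.
  rewrite -[subvect_val _]/(- ('i%C *: (op u))) bopNE bopZE innerNl innerZl.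
  by have /complex_ge0P[] := a0 z; case: (inner _ _) => p q /= _ ->; lra.
have f_le a : T a -> Re (f a) <= numerical_sup a.
  by move=> Ta; have [u <-] := subvect_ex (Ta : vsub_set S a); rewrite fE; exact: g_le.
have f1 : f 1 = 1.
  have /complex_ge0P[_ f1_Im] := functional1_ge0 Tsys f_pos.
  apply: eq_ReIm => //=; apply/eqP; rewrite eq_le; apply/andP; split.
    apply: le_trans (f_le _ T1) _; apply: numerical_sup_le => z.
    by rewrite bop1E inner_self mul1r.
  have := f_le _ (subspaceN Tsub T1); rewrite (linear_onN Tsub fL T1) cReN lerNl.
  apply: le_trans; rewrite lerNr; apply: numerical_sup_le => z.
  by rewrite bopNE bop1E innerNl inner_self mulN1r.
exists f; last by move=> u; rewrite fE.
split; first by split=> //; apply/(cp_functionalP _ Tsub).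
move=> G /(cp_functionalP _ Tsub) GP /(cp_functionalP _ Tsub) fGP.
have /complex_ge0P[t0 _] := functional1_ge0 Tsys GP.
have /complex_ge0P[+ _] := functional1_ge0 Tsys fGP.
rewrite /= f1 cReD cReN subr_ge0 /= => t1.
exists (Re (G 1)); first by rewrite t0 t1.
have bound F (u : subvect S) : positive_functional T F ->
    Re (F (op u)) <= Re (F 1) * numerical_sup (op u).
  move=> FP; apply: le_mul_inf; first exact: numerical_bounds_inf.
    by have /complex_ge0P[] := functional1_ge0 Tsys FP.
  move=> M uM; rewrite mulrC; apply: (functional_Re_le Tsys FP) => //.
  exact: (subvectP u).
have Re_lin F : positive_functional T F ->
    real_linear (fun u : subvect S => Re (F (op u))).
  move=> [FL _]; split=> [u v|t u].
    by rewrite -[subvect_val (u + v)]/(op u + op v) (linear_onD FL) ?cReD //;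
       [exact: (subvectP u) | exact: (subvectP v)].
  rewrite -[subvect_val _]/(t%:C *: (op u)).
  by rewrite (linear_onZ Tsub FL _ (subvectP u)) cReZ.
have [||||||Gg _] := gF (fun u => Re (G (op u))) (fun u => Re ((f \- G) (op u))) (Re (G 1)).
- exact: Re_lin.
- exact: Re_lin.
- by rewrite t0 t1.
- by move=> u; exact: bound.
- move=> u; apply: le_trans (bound _ u fGP) _.
  by rewrite /= f1 cReD cReN.
- by move=> u; rewrite /= cReD cReN fE /= addrC subrK.
have [GL _] := GP.
apply: (linear_on_Re_inj Tsub) => //.
  move=> c a b Ta Tb; rewrite fL // scalerDr; congr (_ + _).
  by rewrite !scalerA mulrC.
move=> a Ta; have [u <-] := subvect_ex (Ta : vsub_set S a).
rewrite -[_ *: f _]/(_ * f _) cReZ fE /=.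
apply/eqP; rewrite eq_le Gg /=; have := Gg (- u).
rewrite real_linearN // -[subvect_val _]/(- (op u)).
by rewrite (linear_onN Tsub GL (subvectP u)) cReN mulrN lerN2.
Qed.

End NumericalSup.

(** The numerical range of s or of - s contains a positive number, and an extreme
    functional attains the supremum of that range. *)
Lemma pure_states_separate (s : bop H) : T s -> adj s = s -> s != 0 ->
  exists2 f, pure_state T f & f s != 0.
Proof.
move=> Ts ss s0.
have [z sz] : exists z, inner (s z) z != 0.
  apply: contrapT => no; move/eqP: s0; apply; apply: bop_quadratic_eq0 => z.
  by apply: contrapT => /eqP sz; apply: no; exists z.
have z0 : z != 0 by apply: contra sz => /eqP ->; rewrite inner0r.
have sz_Im : complex.Im (inner (s z) z) = 0.
  have : inner (s z) z = (inner (s z) z)^*%C by rewrite -innerC -{2}ss -adjP.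
  by move/(congr1 (@complex.Im R)); rewrite cImJ => ?; lra.
suff [a [Ta az aN]] : exists a, [/\ T a, 0 < Re (inner (a z) z) &
    forall f, linear_on T (f : bop H -> R[i]) -> f s = 0 -> f a = 0].
  have [u ua] := subvect_ex (Ta : vsub_set S a).
  have [g [gL gp gu gF]] := extreme_functional u (numerical_sup_sublinear z0).
  have [f fP fg] := extreme_pure_state z0 gL gp gF.
  exists f => //; apply/negP => /eqP fs.
  have := fg u; rewrite {1}ua (aN f) //; last by have [[[]]] := fP.
  rewrite gu ua /= => a0.
  by have := numerical_sup_bound z0 a z; rewrite -a0 mul0r leNgt az.
have [sz0|sz0] := ltP 0 (Re (inner (s z) z)); first by exists s.
exists (- s); split; first exact: (subspaceN Tsub).
  rewrite bopNE innerNl cReN oppr_gt0 lt_def sz0 andbT.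
  apply: contra sz => /eqP sz_Re; apply/eqP/eq_ReIm => //.
by move=> f fL fs; rewrite (linear_onN Tsub fL Ts) fs oppr0.
Qed.

End PureStates.

(** * C*-algebras of operators and their representations *)

Section GeneratedAlgebra.
Context {R : realType} {H : hilbertType R}.
Implicit Types (S B : set (bop H)).

Lemma Cstar_sub S : S `<=` Cstar S.
Proof. by move=> a Sa B [_]; apply. Qed.

Lemma Cstar_min S B : Cstar_subalgebra B -> S `<=` B -> Cstar S `<=` B.
Proof. by move=> BC SB a; apply. Qed.

Lemma Cstar_subalgebraP S : Cstar_subalgebra (Cstar S).
Proof.
split; [split=> [|c u v Su Sv]|move=> a b Sa Sb|move=> a Sa|move=> a Sa] => B BS;
  have [[Bsub BM Badj Bcl] SB] := BS.
- exact: Bsub.1.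
- by apply: Bsub.2; [exact: (Su B BS) | exact: (Sv B BS)].
- by apply: BM; [exact: (Sa B BS) | exact: (Sb B BS)].
- by apply: Badj; exact: (Sa B BS).
- by apply: Bcl => e /Sa[b Sb ab]; exists b => //; exact: (Sb B BS).
Qed.

Lemma Cstar_system S : S 1 -> operator_system (Cstar S).
Proof.
move=> S1; have [Csub _ Cadj _] := Cstar_subalgebraP S.
by split=> //; exact: Cstar_sub.
Qed.

End GeneratedAlgebra.

Lemma expr_small (R : realType) (q d : R) : 0 <= q < 1 -> 0 < d ->
  exists n, q ^+ n < d.
Proof.
move=> /andP[q0 q1] d0; have : `|q| < 1 by rewrite ger0_norm.
move=> /cvg_expr/cvgrPdist_lt/(_ d d0)[n _ /(_ n (leqnn n))] /=.
by rewrite sub0r normrN ger0_norm ?exprn_ge0 // => ?; exists n.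
Qed.

Section Neumann.
Context {R : realType} {K : hilbertType R}.
Variables (A : set (bop K)) (z : bop K).
Hypotheses (AC : Cstar_subalgebra A) (A1 : A 1) (Az : A z) (z1 : opnorm z < 1).

Let q := opnorm z.
Let q0 : 0 <= q. Proof. exact: opnorm_ge0. Qed.
Let u n : bop K := \sum_(k < n) z ^+ k.
Let e n := q ^+ n / (1 - q).

Let Apow n : A (z ^+ n).
Proof.
have [_ AM _ _] := AC; elim: n => [|n IH]; first by rewrite expr0.
by rewrite exprS; exact: AM.
Qed.

Let pow_le n x : hnorm ((z ^+ n) x) <= q ^+ n * hnorm x.
Proof.
elim: n => [|n IH]; first by rewrite !expr0 mul1r.
rewrite !exprS bopME; apply: le_trans (opnorm_ub _ _) _.
by rewrite -mulrA ler_wpM2l.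
Qed.

Let uS n : u n.+1 = u n + z ^+ n.
Proof. by rewrite /u big_ord_recr. Qed.

Let u_cauchy x n m : (n <= m)%N ->
  hnorm (u m x - u n x) <= (q ^+ n - q ^+ m) / (1 - q) * hnorm x.
Proof.
have q1 : 0 < 1 - q by rewrite subr_gt0.
move=> /subnK <-; elim: (m - n)%N => [|k IH].
  by rewrite add0n !subrr psdnorm0 mul0r mul0r.
rewrite addSn uS bopDE addrAC.
apply: le_trans (psdnormD _ _ _) _.
apply: le_trans (lerD IH (pow_le _ _)) _; rewrite -mulrDl ler_wpM2r ?psdnorm_ge0 //.
rewrite le_eqVlt; apply/orP; left; apply/eqP; rewrite exprS.
by field; rewrite gt_eqF.
Qed.

Let e_small (C d : R) : 0 <= C -> 0 < d -> exists n, C * e n < d.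
Proof.
move=> C0 d0; have q1 : 0 < 1 - q by rewrite subr_gt0.
have C1 : 0 < C + 1 by rewrite ltr_wpDl.
have [||n qn] := @expr_small R q (d * (1 - q) / (C + 1)).
- by rewrite q0.
- by rewrite divr_gt0 ?mulr_gt0.
exists n; rewrite /e mulrA ltr_pdivrMr //; rewrite ltr_pdivlMr // in qn.
apply: le_lt_trans qn; rewrite mulrC ler_wpM2l ?exprn_ge0 //; lra.
Qed.

Let u_cauchy' x n m : (n <= m)%N -> hnorm (u m x - u n x) <= hnorm x * e n.
Proof.
move=> /(u_cauchy x) /le_trans; apply; rewrite mulrC ler_wpM2l ?psdnorm_ge0 //.
by rewrite ler_pM2r ?invr_gt0 ?subr_gt0 // lerBlDr lerDl exprn_ge0.
Qed.

(** The geometric series of z converges uniformly on the unit ball, so its sum is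
    a norm limit of elements of A. *)
Lemma neumann : exists2 y, A y & y * (1 - z) = 1.
Proof.
have e0 n : 0 <= e n by rewrite divr_ge0 ?exprn_ge0 // subr_ge0 ltW.
have /choice[f fP] x : exists l, forall n, hnorm (l - u n x) <= hnorm x * e n.
  apply: hilbert_complete => [n m|d d0]; first exact: u_cauchy'.
  by apply: e_small => //; exact: psdnorm_ge0.
have f_unique x l C : 0 <= C -> (forall n, hnorm (l - u n x) <= C * e n) -> l = f x.
  move=> C0 lu; apply/eqP; rewrite -subr_eq0; apply/eqP/hnorm_eq0/eqP.
  rewrite eq_le psdnorm_ge0 andbT -[leRHS]addr0; apply/ler_addgt0Pl => /= d d0.
  rewrite addr0; have [|n en] := e_small (_ : 0 <= C + hnorm x) d0.
    by rewrite addr_ge0 ?psdnorm_ge0.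
  have -> : l - f x = (l - u n x) - (f x - u n x) by rewrite opprB addrA subrK.
  apply: le_trans (psdnormD _ _ _) _; rewrite psdnormN.
  by have := lu n; have := fP x n; rewrite mulrDl in en; lra.
have [||y yf] := @mk_bop R K f (1 + e 0).
- move=> c x x'; apply/esym.
  apply: (f_unique _ _ (Normc.normc c * hnorm x + hnorm x')) => [|n].
    by rewrite addr_ge0 ?mulr_ge0 ?psdnorm_ge0 ?normc_ge0.
  rewrite bopL opprD addrACA -scalerBr.
  apply: le_trans (psdnormD _ _ _) _; rewrite mulrDl -mulrA psdnormZ.
  by rewrite lerD ?fP // ler_wpM2l ?normc_ge0.
- move=> x; have := fP x 0; rewrite /u big_ord0 bop0E subr0.
  by have := psdnorm_ge0 (hilbert_psd K) x; lra.
have Asub : subspace A by case: AC.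
exists y.
  have [_ _ _ Acl] := AC; apply: Acl => d d0.
  have [n en] := e_small ler01 d0; exists (u n).
    by apply: subspace_sum => // k _; exact: Apow.
  rewrite mul1r in en; apply: le_lt_trans en; apply: opnorm_le => // x.
  by rewrite bopBE yf mulrC.
apply: bopP => x; rewrite bopME yf bop1E; apply/esym.
apply: (f_unique _ _ (hnorm x * (1 - q))) => [|n].
  by rewrite mulr_ge0 ?psdnorm_ge0 // subr_ge0 ltW.
have -> : x - u n ((1 - z) x) = (z ^+ n) x.
  have : u n * (1 - z) = 1 - z ^+ n.
    elim: n => [|n IH]; first by rewrite /u big_ord0 mul0r expr0 subrr.
    by rewrite uS mulrDl IH mulrBr mulr1 -exprSr addrA subrK.
  by move/(congr1 (fun a : bop K => a x)); rewrite bopME bopBE => ->; rewrite subKr.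
apply: le_trans (pow_le _ _) _; rewrite /e mulrAC mulrA divfK; first by rewrite mulrC.
by rewrite subr_eq0 gt_eqF.
Qed.

End Neumann.

Section Representations.
Context {R : realType} {K H : hilbertType R}.
Variables (A : set (bop K)) (rho : bop K -> bop H).
Hypotheses (AC : Cstar_subalgebra A) (A1 : A 1).
Hypotheses (rhoR : star_representation A rho) (rho1 : rho 1 = 1).

Let Asub : subspace A. Proof. by case: AC. Qed.
Let AM a b : A a -> A b -> A (a * b). Proof. by case: AC => _ + _ _; exact. Qed.
Let Aadj a : A a -> A (adj a). Proof. by case: AC => _ _ + _; exact. Qed.
Let rhoL : linear_on A rho. Proof. by case: rhoR. Qed.
Let rhoM a b : A a -> A b -> rho (a * b) = rho a * rho b.
Proof. by case: rhoR => _ + _; exact. Qed.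
Let rho_adj a : A a -> rho (adj a) = adj (rho a).
Proof. by case: rhoR => _ _; exact. Qed.

(** If |a| < m = |rho a|, then 1 - m^-2 a* a is invertible in A, hence
    1 - m^-2 rho(a)* rho(a) is bounded below, which keeps |rho(a) x|^2 below a
    fixed multiple c < 1 of m^2 |x|^2 and contradicts the choice of m. *)
Lemma representation_contractive a : A a -> opnorm (rho a) <= opnorm a.
Proof.
move=> Aa; rewrite leNgt; apply/negP => lt.
set b := rho a in lt; set m := opnorm b in lt.
have m0 : 0 < m by apply: le_lt_trans lt; exact: opnorm_ge0.
have m20 : 0 < m ^+ 2 by rewrite exprn_gt0.
have Aaa : A (adj a * a) by apply: AM => //; exact: Aadj.
pose z : bop K := ((m ^+ 2)^-1)%:C *: (adj a * a).
have Az : A z by exact: (subspaceZ Asub).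
have z1 : opnorm z < 1.
  apply: le_lt_trans (opnormZ_le _ _) _.
  rewrite normcR ger0_norm ?invr_ge0 ?(ltW m20) // mulrC ltr_pdivrMr // mul1r.
  apply: le_lt_trans (opnormM _ _) _; rewrite opnorm_adj expr2.
  by have := opnorm_ge0 a; nra.
have [y Ay yz] := neumann AC A1 Az z1.
have rho_z : rho z = ((m ^+ 2)^-1)%:C *: (adj b * b).
  by rewrite (linear_onZ Asub rhoL _ Aaa) rhoM ?rho_adj //; exact: Aadj.
have {}yz : rho y * (1 - rho z) = 1.
  by rewrite -rho1 -(linear_onB Asub rhoL A1 Az) -rhoM ?yz //; exact: (subspaceB Asub).
(* Adding 1 keeps k positive even when rho y vanishes. *)
pose k := opnorm (rho y) ^+ 2 + 1.
have k0 : 0 < k by rewrite ltr_wpDl ?sqr_ge0.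
have below x : hnorm x ^+ 2 <= k * hnorm ((1 - rho z) x) ^+ 2.
  have : hnorm x <= opnorm (rho y) * hnorm ((1 - rho z) x).
    by apply: le_trans (opnorm_ub _ _); rewrite -bopME yz bop1E.
  rewrite /k -ler_sqr ?nnegrE ?mulr_ge0 ?psdnorm_ge0 ?opnorm_ge0 // exprMn.
  by have := sqr_ge0 (hnorm ((1 - rho z) x)); lra.
have zx x : hnorm ((1 - rho z) x) ^+ 2 <= hnorm x ^+ 2 - (m ^+ 2)^-1 * hnorm (b x) ^+ 2.
  have -> : (1 - rho z) x = x + (- (m ^+ 2)^-1)%:C *: (adj b (b x)).
    by rewrite rho_z !bopE rmorphN scaleNr.
  rewrite psdnorm_add_sq.
  have -> : hilbert_psd H x (adj b (b x)) = inner (b x) (b x) by rewrite adjP.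
  rewrite inner_self /=.
  have : hnorm (adj b (b x)) ^+ 2 <= m ^+ 2 * hnorm (b x) ^+ 2.
    rewrite -exprMn ler_sqr ?nnegrE ?mulr_ge0 ?psdnorm_ge0 ?(ltW m0) //.
    by rewrite /m -(opnorm_adj b) opnorm_ub.
  rewrite -[_ <= _ - _ * _](ler_pM2l m20).
  set B := hnorm (b x) ^+ 2; set C := hnorm (adj b _) ^+ 2; set X := hnorm x ^+ 2.
  have -> : m ^+ 2 * (X + 2 * - (m ^+ 2)^-1 * B + (- (m ^+ 2)^-1) ^+ 2 * C) =
    m ^+ 2 * X - 2 * B + (m ^+ 2)^-1 * C by field; rewrite gt_eqF.
  have -> : m ^+ 2 * (X - (m ^+ 2)^-1 * B) = m ^+ 2 * X - B by field; rewrite gt_eqF.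
  move=> CB.
  suff : (m ^+ 2)^-1 * C <= B by lra.
  by rewrite ler_pdivrMl.
pose c := 1 - k^-1.
have c01 : 0 <= c < 1.
  by rewrite subr_ge0 invf_le1 // lerDr sqr_ge0 ltrBlDr ltrDl invr_gt0.
have bx x : hnorm (b x) <= m * Num.sqrt c * hnorm x.
  rewrite -ler_sqr ?nnegrE ?mulr_ge0 ?psdnorm_ge0 ?sqrtr_ge0 ?(ltW m0) // !exprMn.
  have /andP[c0 _] := c01; rewrite (sqr_sqrtr c0).
  have h1 : m ^+ 2 * hnorm x ^+ 2 <=
      m ^+ 2 * (k * (hnorm x ^+ 2 - (m ^+ 2)^-1 * hnorm (b x) ^+ 2)).
    by rewrite ler_pM2l //; apply: le_trans (below x) _; rewrite ler_pM2l.
  rewrite -(ler_pM2l k0).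
  have -> : k * (m ^+ 2 * c * hnorm x ^+ 2) = m ^+ 2 * (k * hnorm x ^+ 2) - m ^+ 2 * hnorm x ^+ 2.
    by rewrite /c; field; rewrite gt_eqF.
  have e : m ^+ 2 * (k * (hnorm x ^+ 2 - (m ^+ 2)^-1 * hnorm (b x) ^+ 2)) =
    m ^+ 2 * (k * hnorm x ^+ 2) - k * hnorm (b x) ^+ 2 by field; rewrite gt_eqF.
  by rewrite e in h1; lra.
have : m <= m * Num.sqrt c.
  by apply: opnorm_le bx; rewrite mulr_ge0 ?sqrtr_ge0 ?(ltW m0).
rewrite -[leLHS]mulr1 ler_pM2l // leNgt => /negP; apply.
by have /andP[c0 c1] := c01; rewrite -[ltRHS]sqrtr1 ltr_sqrt.
Qed.

(** The elements of A that rho sends into B form a C*-algebra, which is norm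
    closed because rho is contractive. *)
Lemma representation_Cstar_sub (S : set (bop K)) (B : set (bop H)) :
  A = Cstar S -> Cstar_subalgebra B -> (forall s, S s -> B (rho s)) ->
  forall a, A a -> B (rho a).
Proof.
move=> AE [Bsub BM Badj Bcl] SB a Aa.
suff : [set a | A a /\ B (rho a)] a by case.
have : Cstar S a by rewrite -AE.
apply: Cstar_min => {a Aa}; last first.
  by move=> s Ss; split; [rewrite AE; exact: Cstar_sub | exact: SB].
split.
- split; first by split; [exact: Asub.1 | rewrite (linear_on0 Asub rhoL); exact: Bsub.1].
  move=> c u v [Au Bu] [Av Bv]; split; first exact: Asub.2.
  by rewrite rhoL //; exact: Bsub.2.
- by move=> u v [Au Bu] [Av Bv]; split; [exact: AM | rewrite rhoM //; exact: BM].
- by move=> u [Au Bu]; split; [exact: Aadj | rewrite rho_adj //; exact: Badj].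
- move=> a aP; have Aa : A a.
    by have [_ _ _ Acl] := AC; apply: Acl => e /aP[b [Ab _] ab]; exists b.
  split=> //; apply: Bcl => e /aP[b [Ab Bb] ab]; exists (rho b) => //.
  apply: le_lt_trans ab; rewrite -(linear_onB Asub rhoL Aa Ab).
  by apply: representation_contractive; exact: (subspaceB Asub).
Qed.

Lemma representation_image_subspace : subspace (rho @` A).
Proof.
split; first by exists 0; [exact: Asub.1 | exact: (linear_on0 Asub rhoL)].
by move=> c _ _ [a Aa <-] [b Ab <-]; exists (c *: a + b); [exact: Asub.2 | rewrite rhoL].
Qed.

Lemma representation_image_system : operator_system (rho @` A).
Proof.
split; first exact: representation_image_subspace.
  by exists 1.
by move=> _ [a Aa <-]; exists (adj a); [exact: Aadj | exact: rho_adj].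
Qed.

Lemma representation_imageM a b :
  (rho @` A) a -> (rho @` A) b -> (rho @` A) (a * b).
Proof. by move=> [u Au <-] [v Av <-]; exists (u * v); [exact: AM | exact: rhoM]. Qed.

End Representations.

Section NormClosure.
Context {R : realType} {H : hilbertType R}.
Implicit Types (D B : set (bop H)).
Local Notation Re := complex.Re.
Local Notation normc := Normc.normc.

Definition norm_closure D : set (bop H) :=
  [set a | forall e : R, 0 < e -> exists2 d, D d & opnorm (a - d) < e].

Lemma norm_closure_sub D : D `<=` norm_closure D.
Proof.
move=> a Da e e0; exists a => //; rewrite subrr.
by apply: le_lt_trans e0; apply: opnorm_le => // x; rewrite bop0E psdnorm0 mul0r.
Qed.

Lemma norm_closure_Cstar D : operator_system D ->
  (forall a b, D a -> D b -> D (a * b)) -> Cstar_subalgebra (norm_closure D).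
Proof.
move=> [Dsub D1 Dadj] DM; split.
- split; first exact: (norm_closure_sub Dsub.1).
  move=> c u v uP vP e e0.
  have k0 : 0 < normc c + 1 by rewrite ltr_wpDl ?normc_ge0.
  have [|u' Du uu] := uP (e / 2 / (normc c + 1)); first by rewrite divr_gt0 //; lra.
  have [|v' Dv vv] := vP (e / 2); first lra.
  exists (c *: u' + v'); first exact: Dsub.2.
  rewrite opprD addrACA -scalerBr; apply: le_lt_trans (opnormD _ _) _.
  have := opnormZ_le c (u - u'); have := opnorm_ge0 (u - u').
  by rewrite ltr_pdivlMr // in uu; have := normc_ge0 c; nra.
- move=> u v uP vP e e0.
  have k0 : 0 < opnorm v + 1 by rewrite ltr_wpDl ?opnorm_ge0.
  have [|u' Du uu] := uP (e / 2 / (opnorm v + 1)); first by rewrite divr_gt0 //; lra.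
  have k'0 : 0 < opnorm u' + 1 by rewrite ltr_wpDl ?opnorm_ge0.
  have [|v' Dv vv] := vP (e / 2 / (opnorm u' + 1)); first by rewrite divr_gt0 //; lra.
  exists (u' * v'); first exact: DM.
  have -> : u * v - u' * v' = (u - u') * v + u' * (v - v').
    by rewrite mulrBl mulrBr addrA subrK.
  apply: le_lt_trans (opnormD _ _) _.
  rewrite ltr_pdivlMr // in uu; rewrite ltr_pdivlMr // in vv.
  have := opnormM (u - u') v; have := opnormM u' (v - v').
  by have := opnorm_ge0 (u - u'); have := opnorm_ge0 (v - v'); lra.
- move=> u uP e /uP[u' Du uu]; exists (adj u'); first exact: Dadj.
  by rewrite -adjB opnorm_adj.
- move=> a aP e e0; have [|b bP ab] := aP (e / 2); first lra.
  have [|d Dd bd] := bP (e / 2); first lra.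
  exists d => //; have -> : a - d = (a - b) + (b - d) by rewrite addrA subrK.
  by apply: le_lt_trans (opnormD _ _) _; lra.
Qed.

(** Positive functionals are continuous, so they are determined on a norm dense
    subset. *)
Lemma dense_unique_extension D B (f : bop H -> R[i]) :
  operator_system B -> positive_functional B f -> D `<=` B ->
  B `<=` norm_closure D -> unique_extension D B f.
Proof.
move=> Bsys fP DB BD g; have [Bsub _ _] := Bsys.
move=> /(cp_functionalP _ Bsub) gP gf b Bb.
pose C := 2 * (Re (f 1) + Re (g 1)) + 1.
have /complex_ge0P[f0 _] := functional1_ge0 Bsys fP.
have /complex_ge0P[g0 _] := functional1_ge0 Bsys gP.
have C0 : 0 < C by rewrite /C; lra.
apply/eqP; rewrite -subr_eq0; apply/eqP/normc_eq0/eqP.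
rewrite eq_le normc_ge0 andbT -[leRHS]addr0; apply/ler_addgt0Pl => /= e e0.
rewrite addr0; have [|d Dd bd] := BD _ Bb (e / C); first exact: divr_gt0.
have Bd := DB _ Dd; have Bbd := subspaceB Bsub Bb Bd.
have -> : g b - f b = g (b - d) - f (b - d).
  have xyz (x y z : R[i]) : x - y = (x - z) - (y - z) by ring.
  rewrite (linear_onB Bsub gP.1 Bb Bd) (linear_onB Bsub fP.1 Bb Bd) (gf d Dd).
  exact: xyz.
apply: le_trans (normcD _ _) _; rewrite normcN.
have := functional_bounded Bsys gP Bbd; have := functional_bounded Bsys fP Bbd.
by rewrite ltr_pdivlMr // /C in bd; have := opnorm_ge0 (b - d); lra.
Qed.

(** A decomposition g + (f - g) of f on D extends to B; by unique extension the
    extensions still add up to f, which is pure. *)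
Lemma pure_state_restrict D B (f : bop H -> R[i]) :
  operator_system D -> operator_system B -> D `<=` B ->
  pure_state B f -> unique_extension D B f -> pure_state D f.
Proof.
move=> Dsys Bsys DB; have [Dsub D1 _] := Dsys; have [Bsub B1 _] := Bsys.
move=> [[/(cp_functionalP _ Bsub) fP f1] f_pure] f_uep.
have restrict (F : bop H -> R[i]) E : positive_functional E F -> (forall a, D a -> E a) ->
    positive_functional D F.
  by move=> [FL F0] DE; split=> [c u v Du Dv|a Da]; [apply: FL; exact: DE | apply: F0; exact: DE].
split; first by split=> //; apply/(cp_functionalP _ Dsub); exact: restrict fP DB.
move=> g /(cp_functionalP _ Dsub) gP /(cp_functionalP _ Dsub) fgP.
have [G [GL Gpos] Gg] := positive_extension Dsys gP.
have [G' [G'L G'pos] G'g] := positive_extension Dsys fgP.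
have BGG a : B a -> G a + G' a = f a.
  apply: (f_uep (fun a => G a + G' a)) => [|d Dd].
    apply/(cp_functionalP _ Bsub); split=> [c u v _ _|a' Ba a0].
      by rewrite GL ?G'L // scalerDr addrACA.
    by rewrite addr_ge0 ?Gpos ?G'pos.
  by rewrite Gg // G'g //= addrC subrK.
have [||t t01 Gt] := f_pure G.
- by apply/(cp_functionalP _ Bsub); split=> [c u v _ _|a' _]; [exact: GL | exact: Gpos].
- apply/(cp_functionalP _ Bsub); split=> [c u v Bu Bv|a' Ba a0] /=.
    by rewrite fP.1 // GL // opprD addrACA scalerBr.
  by rewrite -BGG // addrC addKr G'pos.
by exists t => // a Da; rewrite -Gg // Gt //; exact: DB.
Qed.

End NormClosure.

(** * The Hilbert space of a positive semidefinite form *)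

(** Vectors of the completion are encoded as the bounded antilinear functionals
    v |-> <F, v> on V. These form a complete space, and no quotient by the
    null vectors is needed. *)
Definition gns_pred (R : realType) (V : lmodType R[i]) (h : psd_form V) :
    {pred (V -> R[i])} :=
  mem [set F : V -> R[i] |
    (forall c u v, F (c *: u + v) = c^*%C * F u + F v) /\
    exists M : R, forall w, Normc.normc (F w) <= M * psdnorm h w].

Lemma gns_pred_closed (R : realType) (V : lmodType R[i]) (h : psd_form V) :
  subsemimod_closed (gns_pred h).
Proof.
split; [split|] => /=.
- rewrite inE; split=> [c u v|]; first by rewrite mulr0 addr0.
  by exists 0 => w; rewrite mul0r normc0.
- move=> F G; rewrite !inE => -[FL [M FM]] [GL [N GN]]; split=> [c u v|].
    by rewrite /GRing.add /= FL GL mulrDr addrACA.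
  exists (M + N) => w; rewrite mulrDl.
  exact: le_trans (normcD _ _) (lerD (FM w) (GN w)).
- move=> c F; rewrite !inE => -[FL [M FM]]; split=> [b u v|].
    by rewrite -[LHS]/(c * F _) FL mulrDr mulrCA.
  exists (Normc.normc c * M) => w; rewrite -[(c *: F) w]/(c * F w) normcM -mulrA.
  by rewrite ler_wpM2l ?normc_ge0.
Qed.

HB.instance Definition _ (R : realType) (V : lmodType R[i]) (h : psd_form V) :=
  GRing.isSubmodClosed.Build R[i] (V -> R[i]) (gns_pred h) (gns_pred_closed h).

Record gns (R : realType) (V : lmodType R[i]) (h : psd_form V) := Gns {
  gns_fun :> V -> R[i] ;
  gns_subproof : gns_fun \in gns_pred h }.

HB.instance Definition _ (R : realType) (V : lmodType R[i]) (h : psd_form V) :=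
  [isSub for @gns_fun R V h].
HB.instance Definition _ (R : realType) (V : lmodType R[i]) (h : psd_form V) :=
  [Choice of gns h by <:].
HB.instance Definition _ (R : realType) (V : lmodType R[i]) (h : psd_form V) :=
  [SubChoice_isSubLmodule of gns h by <:].

Section GnsNorm.
Context {R : realType} {V : lmodType R[i]} {h : psd_form V}.
Implicit Types (F G : gns h) (u v w : V).
Local Notation normc := Normc.normc.
Local Notation Re := complex.Re.
Local Notation n := (psdnorm h).

Lemma gnsL F c u v : F (c *: u + v) = c^*%C * F u + F v.
Proof. by have := gns_subproof F; rewrite inE => -[]. Qed.

Lemma gnsB F u v : F (u - v) = F u - F v.
Proof.
by rewrite addrC -scaleN1r gnsL rmorphN rmorph1 mulN1r addrC.
Qed.

Lemma gnsP F G : (forall w, F w = G w) -> F = G.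
Proof. by move=> FG; apply/val_inj/funext. Qed.

Lemma gns_bounded F : exists M : R, forall w, normc (F w) <= M * n w.
Proof. by have := gns_subproof F; rewrite inE => -[]. Qed.

Definition dual_norm F : R :=
  inf [set M : R | 0 <= M /\ forall w, normc (F w) <= M * n w].

Lemma dual_norm_has_inf F :
  has_inf [set M : R | 0 <= M /\ forall w, normc (F w) <= M * n w].
Proof.
split; last by exists 0 => M [].
have [M FM] := gns_bounded F; exists (Num.max M 0); split.
  by rewrite le_max lexx orbT.
move=> w; apply: le_trans (FM w) _; rewrite ler_wpM2r ?psdnorm_ge0 //.
by rewrite le_max lexx.
Qed.

Lemma dual_norm_le F M : 0 <= M -> (forall w, normc (F w) <= M * n w) ->
  dual_norm F <= M.
Proof. by move=> M0 FM; apply: ge_inf => //; exact: (dual_norm_has_inf F).2. Qed.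

Lemma dual_norm_ub F w : normc (F w) <= dual_norm F * n w.
Proof.
rewrite mulrC; apply: le_mul_inf; [exact: dual_norm_has_inf|exact: psdnorm_ge0|].
by move=> M [_ FM]; rewrite mulrC.
Qed.

Lemma dual_norm_ge0 F : 0 <= dual_norm F.
Proof. by apply: lb_le_inf; [exact: (dual_norm_has_inf F).1 | move=> M []]. Qed.

Lemma dual_normD F G : dual_norm (F + G) <= dual_norm F + dual_norm G.
Proof.
apply: dual_norm_le => [|w]; first by rewrite addr_ge0 ?dual_norm_ge0.
rewrite mulrDl; apply: le_trans (normcD _ _) _.
by rewrite lerD ?dual_norm_ub.
Qed.

Lemma dual_normZ_le c F : dual_norm (c *: F) <= normc c * dual_norm F.
Proof.
apply: dual_norm_le => [|w]; first by rewrite mulr_ge0 ?normc_ge0 ?dual_norm_ge0.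
by rewrite -[gns_fun _ w]/(c * F w) normcM -mulrA ler_wpM2l ?normc_ge0 ?dual_norm_ub.
Qed.

Lemma dual_norm_eq0 F : dual_norm F = 0 -> F = 0.
Proof.
move=> F0; apply: gnsP => w; apply/normc_eq0/eqP; rewrite eq_le normc_ge0 andbT.
by have := dual_norm_ub F w; rewrite F0 mul0r.
Qed.

Lemma dual_normZ c F : dual_norm (c *: F) = normc c * dual_norm F.
Proof.
have [->|c0] := eqVneq c 0.
  rewrite scale0r normc0 mul0r; apply/eqP; rewrite eq_le dual_norm_ge0 andbT.
  by apply: dual_norm_le => // w; rewrite normc0 mul0r.
apply/eqP; rewrite eq_le dual_normZ_le /=.
have c1 : 0 < normc c.
  by rewrite lt_def normc_ge0 andbT; apply: contra c0 => /eqP/normc_eq0 ->.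
rewrite -ler_pdivlMl // -Normc.normcV.
by rewrite -{1}[F]scale1r -(mulVf c0) -scalerA dual_normZ_le.
Qed.

Lemma dual_norm0 : dual_norm (0 : gns h) = 0.
Proof. by rewrite -(scale0r (0 : gns h)) dual_normZ normc0 mul0r. Qed.

Lemma dual_normN F : dual_norm (- F) = dual_norm F.
Proof. by rewrite -scaleN1r dual_normZ normcN Normc.normc1 mul1r. Qed.

Definition gns_vec v : gns h.
Proof.
refine (@Gns R V h (fun w => h v w) _).
rewrite inE; split=> [c u w|]; first by rewrite psdDr psdZr.
by exists (n v) => w; exact: psd_CauchySchwarz.
Defined.

Lemma gns_vecE v w : gns_vec v w = h v w. Proof. by []. Qed.

Lemma gns_vecB u v : gns_vec (u - v) = gns_vec u - gns_vec v.
Proof. by apply: gnsP => w; rewrite gns_vecE psdBl. Qed.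

Lemma dual_norm_vec v : dual_norm (gns_vec v) = n v.
Proof.
apply/eqP; rewrite eq_le; apply/andP; split.
  by apply: dual_norm_le => [|w]; [exact: psdnorm_ge0 | exact: psd_CauchySchwarz].
have [v0|v0] := eqVneq (n v) 0; first by rewrite v0 dual_norm_ge0.
have {}v0 : 0 < n v by rewrite lt_def v0 psdnorm_ge0.
have := dual_norm_ub (gns_vec v) v.
by rewrite gns_vecE psd_self normcR ger0_norm ?sqr_ge0 // expr2 ler_pM2r.
Qed.

(** V is dense, by the approximate form of the Riesz representation theorem. *)
Lemma gns_dense F (e : R) : 0 < e -> exists v, dual_norm (F - gns_vec v) <= e.
Proof.
move=> e0; have [M FM] := gns_bounded F.
have [||w _|v _ vP] := @psd_near_riesz R V h setT (fun w => (F w)^*%C) M _ _ _ e e0.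
- by [].
- by move=> c u v _ _ /=; rewrite gnsL rmorphD rmorphM /= conjcK.
- by rewrite normcJ.
exists v; apply: dual_norm_le => [|w]; first exact: ltW.
rewrite -[gns_fun _ w]/(F w - h v w) -normcJ rmorphB /= -psdC.
exact: vP.
Qed.

Let ler_normD F G :
  (dual_norm (F + G))%:C <= (dual_norm F)%:C + (dual_norm G)%:C.
Proof. by rewrite -rmorphD lecR dual_normD. Qed.

Let normrZ c F : (dual_norm (c *: F))%:C = `|c| * (dual_norm F)%:C.
Proof. by rewrite dual_normZ rmorphM. Qed.

Let normr0_eq0 F : (dual_norm F)%:C = 0 -> F = 0.
Proof. by move=> /complexI; exact: dual_norm_eq0. Qed.

HB.instance Definition _ :=
  @Lmodule_isNormed.Build R[i] (gns h) (fun F => (dual_norm F)%:C)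
    ler_normD normrZ normr0_eq0.

End GnsNorm.

Section GnsHilbert.
Context {R : realType} {V : lmodType R[i]} {h : psd_form V}.
Implicit Types (F G : gns h) (u v w : V).
Local Notation normc := Normc.normc.
Local Notation Re := complex.Re.
Local Notation n := (psdnorm h).

Lemma gns_normE F : `|F| = (dual_norm F)%:C. Proof. by []. Qed.

Lemma gns_complete (Fl : set_system (gns h)) :
  ProperFilter Fl -> cauchy Fl -> cvg Fl.
Proof.
move=> FlP Flc; pose e k : R := k.+1%:R^-1.
have e0 k : 0 < e k by rewrite invr_gt0.
have e_le k l : (k <= l)%N -> e l <= e k.
  by move=> kl; rewrite lef_pV2 ?posrE // ler_nat.
have /choice[G GP] k : exists F, Fl (ball F (e k)%:C).
  by apply: (cauchyP _).1 => //; rewrite ltcR.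
have ballP F (r : R) : ball F r%:C = [set F' | dual_norm (F - F') < r].
  by rewrite -ball_normE; apply/seteqP; split=> F' /=; rewrite gns_normE ltcR.
have GG k l : (k <= l)%N -> dual_norm (G l - G k) <= 2 * e k.
  move=> kl; have [F []] := filter_ex (filterI (GP k) (GP l)).
  rewrite !ballP /= => GkF GlF.
  have -> : G l - G k = (G l - F) - (G k - F) by rewrite opprB addrA subrK.
  apply: le_trans (dual_normD _ _) _; rewrite dual_normN.
  by have := e_le _ _ kl; lra.
have /choice[L LP] w : exists z, forall k, normc (z - G k w) <= 2 * (2 * e k * n w).
  apply: complex_nested => k l kl.
  rewrite -[G l w - G k w]/((G l - G k) w).
  apply: le_trans (dual_norm_ub _ _) _; rewrite ler_wpM2r ?psdnorm_ge0 //.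
  exact: GG.
have Lgns : L \in gns_pred h.
  rewrite inE; split=> [c u v|].
    apply/eqP; rewrite -subr_eq0; apply/eqP.
    apply: (@normc_small _ _ (4 * n (c *: u + v) + 4 * (normc c * n u) + 4 * n v)) => k.
    have -> : L (c *: u + v) - (c^*%C * L u + L v) = (L (c *: u + v) - G k (c *: u + v))
        - c^*%C * (L u - G k u) - (L v - G k v).
      by rewrite gnsL; ring.
    apply: le_trans (normcD _ _) _; rewrite normcN.
    apply: le_trans (lerD (normcD _ _) (lexx _)) _; rewrite normcN normcM normcJ.
    have := LP (c *: u + v) k; have := LP v k.
    have := ler_wpM2l (normc_ge0 c) (LP u k).
    by rewrite -/(e k); lra.
  exists (4 * e 0%N + dual_norm (G 0%N)) => w.
  have -> : L w = (L w - G 0%N w) + G 0%N w by rewrite subrK.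
  apply: le_trans (normcD _ _) _; have := LP w 0%N; have := dual_norm_ub (G 0%N) w.
  lra.
apply/cvg_ex; exists (Gns Lgns) => B /nbhs_ballP[r /= r0 rB].
have := r0; rewrite ltcE /= => /andP[/eqP rIm rRe].
have rE : r = (Re r)%:C by move: rIm; case: (r) => a b /= ->.
have [|k ek] := @inv_small R (Re r / 5); first lra.
apply: filterS (GP k) => F; rewrite ballP /= => GkF; apply: rB.
rewrite rE ballP /=.
have -> : Gns Lgns - F = (Gns Lgns - G k) + (G k - F) by rewrite addrA subrK.
apply: le_lt_trans (dual_normD _ _) _.
have : dual_norm (Gns Lgns - G k) <= 4 * e k.
  apply: dual_norm_le => [|w]; first by rewrite mulr_ge0 ?(ltW (e0 k)).
  by rewrite -[gns_fun _ w]/(L w - G k w); have := LP w k; lra.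
by rewrite -/(e k) in ek; lra.
Qed.

HB.instance Definition _ := Uniform_isComplete.Build (gns h) gns_complete.

(** The values F v converge as v tends to G; the limit is the inner product of F
    and G. *)
Lemma gns_inner_exists F G : exists z : R[i], forall v,
  normc (z - F v) <= dual_norm F * dual_norm (G - gns_vec v).
Proof.
pose e k : R := k.+1%:R^-1.
have e0 k : 0 < e k by rewrite invr_gt0.
have e_le k l : (k <= l)%N -> e l <= e k.
  by move=> kl; rewrite lef_pV2 ?posrE // ler_nat.
have /choice[a aP] k := gns_dense G (e0 k).
have vec_close u v : n (u - v) <= dual_norm (G - gns_vec u) + dual_norm (G - gns_vec v).
  rewrite -dual_norm_vec gns_vecB.
  have -> : @gns_vec R V h u - gns_vec v = (G - gns_vec v) - (G - gns_vec u).
    by rewrite opprB [RHS]addrC addrA subrK.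
  by apply: le_trans (dual_normD _ _) _; rewrite dual_normN addrC.
have F_close u v : normc (F u - F v) <=
    dual_norm F * (dual_norm (G - gns_vec u) + dual_norm (G - gns_vec v)).
  rewrite -gnsB; apply: le_trans (dual_norm_ub _ _) _.
  by rewrite ler_wpM2l ?dual_norm_ge0.
have [z zP] : exists z, forall k, normc (z - F (a k)) <= 2 * (dual_norm F * (2 * e k)).
  apply: complex_nested => k l kl; apply: le_trans (F_close _ _) _.
  rewrite ler_wpM2l ?dual_norm_ge0 //.
  by have := aP k; have := aP l; have := e_le _ _ kl; rewrite -!/(e _); lra.
exists z => v; apply: (@le_add_small _ _ _ (5 * dual_norm F)) => k.
have -> : z - F v = (z - F (a k)) + (F (a k) - F v) by rewrite addrA subrK.
apply: le_trans (normcD _ _) _; apply: le_trans (lerD (zP k) (F_close _ _)) _.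
have := ler_wpM2l (dual_norm_ge0 F) (aP k); rewrite -/(e k); lra.
Qed.

Definition gns_inner F G : R[i] := projT1 (cid (gns_inner_exists F G)).

Lemma gns_innerP F G v :
  normc (gns_inner F G - F v) <= dual_norm F * dual_norm (G - gns_vec v).
Proof. exact: projT2 (cid (gns_inner_exists F G)) v. Qed.

(** This is the reproducing property of the functionals that encode vectors. *)
Lemma gns_inner_vec F v : gns_inner F (gns_vec v) = F v.
Proof.
apply/eqP; rewrite -subr_eq0; apply/eqP/normc_eq0/eqP.
rewrite eq_le normc_ge0 andbT; apply: le_trans (gns_innerP _ _ v) _.
by rewrite subrr dual_norm0 mulr0.
Qed.

Lemma gns_inner_linear c F F' G :
  gns_inner (c *: F + F') G = c * gns_inner F G + gns_inner F' G.
Proof.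
apply/eqP; rewrite -subr_eq0; apply/eqP.
apply: (@normc_small _ _ (dual_norm (c *: F + F') + normc c * dual_norm F + dual_norm F')) => k.
set e : R := k.+1%:R^-1; have e0 : 0 < e by rewrite invr_gt0.
have [v vG] := gns_dense G e0.
have -> : gns_inner (c *: F + F') G - (c * gns_inner F G + gns_inner F' G) =
    (gns_inner (c *: F + F') G - (c *: F + F') v) - c * (gns_inner F G - F v)
    - (gns_inner F' G - F' v).
  by rewrite -[(_ + F') v]/(c * F v + F' v); ring.
apply: le_trans (normcD _ _) _; rewrite normcN.
apply: le_trans (lerD (normcD _ _) (lexx _)) _; rewrite normcN normcM.
have close E : normc (gns_inner E G - E v) <= dual_norm E * e.
  by apply: le_trans (gns_innerP _ _ _) _; rewrite ler_wpM2l ?dual_norm_ge0.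
have := close (c *: F + F'); have := close F'.
have := ler_wpM2l (normc_ge0 c) (close F); lra.
Qed.

(** The inner product is approximated by the form on V, from which it therefore
    inherits its identities. *)
Lemma gns_inner_approx F G (e : R) u v : e <= 1 ->
  dual_norm (F - gns_vec u) <= e -> dual_norm (G - gns_vec v) <= e ->
  normc (gns_inner F G - h u v) <= (dual_norm F + dual_norm G + 1) * e.
Proof.
move=> e1 uF vG; have e0 : 0 <= e by apply: le_trans uF; exact: dual_norm_ge0.
have -> : gns_inner F G - h u v = (gns_inner F G - F v) + (F - gns_vec u) v.
  by rewrite -[(F - _) v]/(F v - h u v) addrA subrK.
apply: le_trans (normcD _ _) _.
have := gns_innerP F G v; have := dual_norm_ub (F - gns_vec u) v.
have vn : n v <= dual_norm G + 1.
  rewrite -dual_norm_vec; have -> : @gns_vec R V h v = G - (G - gns_vec v) by rewrite subKr.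
  by apply: le_trans (dual_normD _ _) _; rewrite dual_normN; lra.
have := ler_wpM2l (dual_norm_ge0 F) vG.
have : dual_norm (F - gns_vec u) * n v <= e * (dual_norm G + 1).
  by apply: ler_pM => //; [exact: dual_norm_ge0 | exact: psdnorm_ge0].
lra.
Qed.

Lemma gns_innerC F G : gns_inner G F = (gns_inner F G)^*%C.
Proof.
apply/eqP; rewrite -subr_eq0; apply/eqP.
apply: (@normc_small _ _ (2 * (dual_norm F + dual_norm G + 1))) => k.
set e : R := k.+1%:R^-1; have e0 : 0 < e by rewrite invr_gt0.
have e1 : e <= 1 by rewrite invf_le1 // ler1n.
have [u uF] := gns_dense F e0; have [v vG] := gns_dense G e0.
have -> : gns_inner G F - (gns_inner F G)^*%C =
    (gns_inner G F - h v u) - (gns_inner F G - h u v)^*%C.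
  by rewrite rmorphB /= -[(h u v)^*%C]psdC; ring.
apply: le_trans (normcD _ _) _; rewrite normcN normcJ.
have := gns_inner_approx e1 uF vG; have := gns_inner_approx e1 vG uF; lra.
Qed.

Lemma gns_inner_self F : gns_inner F F = (dual_norm F ^+ 2)%:C.
Proof.
apply/eqP; rewrite -subr_eq0; apply/eqP.
apply: (@normc_small _ _ (4 * dual_norm F + 2)) => k.
set e : R := k.+1%:R^-1; have e0 : 0 < e by rewrite invr_gt0.
have e1 : e <= 1 by rewrite invf_le1 // ler1n.
have [u uF] := gns_dense F e0.
have -> : gns_inner F F - (dual_norm F ^+ 2)%:C =
    (gns_inner F F - h u u) + (n u ^+ 2 - dual_norm F ^+ 2)%:C.
  by rewrite psd_self rmorphB /=; ring.
apply: le_trans (normcD _ _) _; rewrite normcR.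
have := gns_inner_approx e1 uF uF.
have nu : `|n u - dual_norm F| <= e.
  rewrite -dual_norm_vec ler_norml; apply/andP; split.
    have := dual_normD (F - gns_vec u) (gns_vec u); rewrite subrK; lra.
  have := dual_normD F (- (F - gns_vec u)); rewrite subKr dual_normN; lra.
have : `|n u ^+ 2 - dual_norm F ^+ 2| <= e * (2 * dual_norm F + 1).
  rewrite subr_sqr normrM; apply: ler_pM => //.
  move: nu; rewrite ler_norml => /andP[nu1 nu2].
  rewrite ger0_norm ?addr_ge0 ?psdnorm_ge0 ?dual_norm_ge0 //; lra.
lra.
Qed.

Let inner_zmodl G : zmod_morphism (gns_inner^~ G).
Proof.
by move=> F F'; rewrite addrC -scaleN1r gns_inner_linear mulN1r addrC.
Qed.

Let inner_scalel G : scalable_for *%R (gns_inner^~ G).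
Proof.
move=> c F; have := gns_inner_linear c F 0 G; rewrite addr0 => ->.
by have := inner_zmodl G F F; rewrite !subrr => ->; rewrite addr0.
Qed.

Let inner_zmodr F : zmod_morphism (gns_inner F).
Proof.
by move=> G G'; rewrite gns_innerC inner_zmodl rmorphB /= -!gns_innerC.
Qed.

Let inner_scaler F : scalable_for (Num.conj \; *%R) (gns_inner F).
Proof.
by move=> c G; rewrite gns_innerC inner_scalel rmorphM /= -gns_innerC.
Qed.

HB.instance Definition _ := isBilinear.Build R[i] (gns h) (gns h) R[i]
  *%R (Num.conj \; *%R) gns_inner inner_zmodl inner_zmodr inner_scalel inner_scaler.

Let inner_hermitian F G : gns_inner F G = (-1) ^+ false * Num.conj (gns_inner G F).
Proof. by rewrite expr0 mul1r gns_innerC. Qed.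

HB.instance Definition _ := isHermitianSesquilinear.Build R[i] (gns h) false
  Num.conj gns_inner inner_hermitian.

Let inner_gt0 F : F != 0 -> 0 < gns_inner F F.
Proof.
move=> F0; rewrite gns_inner_self ltcR exprn_gt0 // lt_def dual_norm_ge0 andbT.
by apply: contra F0 => /eqP/dual_norm_eq0 ->.
Qed.

HB.instance Definition _ := isDotProduct.Build R[i] (gns h) gns_inner inner_gt0.

Let inner_normE F : gns_inner F F = `|F| ^+ 2.
Proof. by rewrite gns_inner_self gns_normE rmorphXn. Qed.

HB.instance Definition _ := isHilbert.Build R (gns h) inner_normE.

Lemma gns_hnorm F : hnorm F = dual_norm F.
Proof. by have := hnormE F; rewrite gns_normE => /complexI. Qed.

End GnsHilbert.

(** These properties determine the completion up to isometry, and the arguments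
    below rely on them alone, not on a construction. *)
Record is_completion (R : realType) (V : lmodType R[i]) (h : psd_form V)
    (L : hilbertType R) (vec : V -> L) : Prop := IsCompletion {
  vec_inner : forall u v, inner (vec u) (vec v) = h u v ;
  vec_sep : forall x y : L,
    (forall w, inner x (vec w) = inner y (vec w)) -> x = y ;
  vec_dense : forall (x : L) (e : R), 0 < e -> exists v, hnorm (x - vec v) <= e ;
  vec_represent : forall (f : V -> R[i]) (M : R), 0 <= M ->
    (forall c u v, f (c *: u + v) = c^*%C * f u + f v) ->
    (forall w, Normc.normc (f w) <= M * psdnorm h w) ->
    exists2 x, hnorm x <= M & forall w, inner x (vec w) = f w }.

Lemma completion_exists (R : realType) (V : lmodType R[i]) (h : psd_form V) :
  exists (L : hilbertType R) (vec : V -> L), is_completion h vec.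
Proof.
exists (gns h : hilbertType R), (@gns_vec R V h).
have inner_vec F w : inner F (gns_vec w) = F w by exact: gns_inner_vec.
split=> [u v|F G FG|F e e0|f M M0 fL fM].
- exact: inner_vec.
- by apply: gnsP => w; rewrite -!inner_vec.
- by have [v vF] := gns_dense F e0; exists v; rewrite gns_hnorm.
have fP : f \in gns_pred h by rewrite inE; split=> //; exists M.
exists (Gns fP); first by rewrite gns_hnorm; exact: dual_norm_le.
by move=> w; rewrite inner_vec.
Qed.

(** * The representation of a positive functional *)

Section OperatorForm.
Context {R : realType} {H : hilbertType R}.
Implicit Types (a b : bop H).
Local Notation normc := Normc.normc.
Local Notation Re := complex.Re.

Lemma subspace_setT : subspace [set: bop H].
Proof. by []. Qed.

Lemma operator_system_setT : operator_system [set: bop H].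
Proof. by []. Qed.

Variables (psi : bop H -> R[i]) (psiP : positive_functional setT psi).

Let psiL c a b : psi (c *: a + b) = c * psi a + psi b.
Proof. exact: psiP.1. Qed.

Definition functional_form : psd_form (bop H).
Proof.
refine (@PsdForm R (bop H) (fun u v => psi (adj v * u)) _ _ _).
- by move=> c u v w; rewrite mulrDr bop_scalerAr psiL.
- move=> u v; rewrite -(functional_adj operator_system_setT psiP) //.
  by rewrite adjM adjK.
- by move=> v; apply: psiP.2 => //; exact: positive_adjM.
Defined.

Lemma functional_formE u v : functional_form u v = psi (adj v * u).
Proof. by []. Qed.

(** |b| bounds the action of b by left multiplication, as
    u* (|b|^2 - b* b) u is positive. *)
Lemma functional_form_mul b u :
  psdnorm functional_form (b * u) <= opnorm b * psdnorm functional_form u.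
Proof.
rewrite -ler_sqr ?nnegrE ?mulr_ge0 ?psdnorm_ge0 ?opnorm_ge0 // exprMn.
rewrite !psdnorm_sq !functional_formE -cReZ.
have -> : (opnorm b ^+ 2)%:C * psi (adj u * u) = psi ((opnorm b ^+ 2)%:C *: (adj u * u)).
  by rewrite (linear_onZ subspace_setT psiP.1).
rewrite -subr_ge0 -cReN -cReD -(linear_onB subspace_setT psiP.1) //.
apply: (functional_Re_ge0 operator_system_setT psiP) => // x.
rewrite bopBE bopZE innerBl innerZl !inner_adj_self -rmorphM -rmorphB /= subr_ge0.
by rewrite -exprMn ler_sqr ?nnegrE ?mulr_ge0 ?psdnorm_ge0 ?opnorm_ge0 // opnorm_ub.
Qed.

Lemma functional_bound a u v : normc (psi (adj v * (a * u))) <=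
  opnorm a * psdnorm functional_form u * psdnorm functional_form v.
Proof.
apply: le_trans (psd_CauchySchwarz functional_form (a * u) v) _.
by rewrite ler_wpM2r ?psdnorm_ge0 ?functional_form_mul.
Qed.

Variable D : vsubspace (bop H).
Local Notation V := (subvect D).
Local Notation op u := (subvect_val u : bop H).

Definition subspace_form : psd_form V.
Proof.
refine (@PsdForm R V (fun u v => functional_form (op u) (op v)) _ _ _).
- by move=> c u v w; rewrite -psdL.
- by move=> u v; exact: psdC.
- by move=> v; exact: psd_ge0.
Defined.

Local Notation h := subspace_form.

Variables (L : hilbertType R) (vec : V -> L) (vecP : is_completion h vec).

(** Since b w need not belong to D, its projection to the completion of D is
    obtained as the vector representing u |-> <b w, u>. *)
Lemma compress_vec_exists (b : bop H) (w : V) : exists x : L,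
  hnorm x <= opnorm b * psdnorm h w /\ forall u, inner x (vec u) = psi (adj (op u) * (b * op w)).
Proof.
have [||u|x xn xP] := vec_represent vecP
  (f := fun u => psi (adj (op u) * (b * op w))) (M := opnorm b * psdnorm h w).
- by rewrite mulr_ge0 ?opnorm_ge0 ?psdnorm_ge0.
- move=> c u v.
  by rewrite -[op (c *: u + v)]/(c *: op u + op v) adjL mulrDl bop_scalerAl psiL.
- exact: functional_bound.
by exists x.
Qed.

Definition compress_vec b w : L := projT1 (cid (compress_vec_exists b w)).

Lemma compress_vec_norm b w : hnorm (compress_vec b w) <= opnorm b * psdnorm h w.
Proof. exact: (projT2 (cid (compress_vec_exists b w))).1. Qed.

Lemma compress_vecP b w u :
  inner (compress_vec b w) (vec u) = psi (adj (op u) * (b * op w)).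
Proof. exact: (projT2 (cid (compress_vec_exists b w))).2. Qed.

Lemma compress_vecL b c u v :
  compress_vec b (c *: u + v) = c *: compress_vec b u + compress_vec b v.
Proof.
apply: (vec_sep vecP) => w; rewrite innerDl innerZl !compress_vecP.
by rewrite -[op (c *: u + v)]/(c *: op u + op v) !mulrDr !bop_scalerAr psiL.
Qed.

(** The compression of left multiplication by b to the completion of D: its
    value at x is the vector representing w |-> <x, b* w>. *)
Lemma compress_exists b : exists T : bop L,
  forall x w, inner (T x) (vec w) = inner x (compress_vec (adj b) w).
Proof.
have /choice[f fP] x : exists y, hnorm y <= hnorm x * opnorm b /\ forall w, inner y (vec w) = inner x (compress_vec (adj b) w).
  have [||w|y yn yP] := vec_represent vecP
    (f := fun w => inner x (compress_vec (adj b) w)) (M := hnorm x * opnorm b).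
  - by rewrite mulr_ge0 ?opnorm_ge0 ?psdnorm_ge0.
  - by move=> c u v; rewrite compress_vecL innerDr innerZr.
  - apply: le_trans (inner_CauchySchwarz _ _) _; rewrite -mulrA.
    by rewrite ler_wpM2l ?psdnorm_ge0 // -(opnorm_adj b) compress_vec_norm.
  by exists y.
have [||T Tf] := @mk_bop R L f (opnorm b).
- move=> c x y; apply: (vec_sep vecP) => w.
  by rewrite innerDl innerZl !(fP _).2 innerDl innerZl.
- by move=> x; rewrite mulrC (fP x).1.
by exists T => x w; rewrite Tf (fP x).2.
Qed.

Definition compress b : bop L := projT1 (cid (compress_exists b)).

Lemma compressP b x w : inner (compress b x) (vec w) = inner x (compress_vec (adj b) w).
Proof. exact: (projT2 (cid (compress_exists b))). Qed.

Lemma compress_inner b v w :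
  inner (compress b (vec v)) (vec w) = psi (adj (op w) * (b * op v)).
Proof.
rewrite compressP innerC compress_vecP.
rewrite -(functional_adj operator_system_setT psiP) //.
by rewrite !adjM !adjK mulrA.
Qed.

Lemma bop_vec_ext (X Y : bop L) :
  (forall v w, inner (X (vec v)) (vec w) = inner (Y (vec v)) (vec w)) -> X = Y.
Proof.
move=> XY; have XYv v : X (vec v) = Y (vec v).
  by apply: (vec_sep vecP) => w; rewrite XY.
have XYa w : adj X (vec w) = adj Y (vec w).
  by apply: (vec_sep vecP) => v; rewrite !adjPr XYv.
by apply: bopP => x; apply: (vec_sep vecP) => w; rewrite !adjP XYa.
Qed.

Lemma compress_linear c a b : compress (c *: a + b) = c *: compress a + compress b.
Proof.
apply: bop_vec_ext => v w.
rewrite bopDE bopZE innerDl innerZl !compress_inner.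
by rewrite mulrDl bop_scalerAl mulrDr bop_scalerAr psiL.
Qed.

Lemma compress_adj b : compress (adj b) = adj (compress b).
Proof.
apply: bop_vec_ext => v w.
rewrite compress_inner adjPr [RHS]innerC compress_inner -(functional_adj operator_system_setT psiP) //.
by rewrite !adjM !adjK mulrA.
Qed.

(** The expression is continuous in x, and the vectors of D are dense. *)
Lemma quadratic_dense_ge0 m (X : 'M[bop L]_m) :
  (forall v : 'I_m -> V, 0 <= \sum_i \sum_j inner (X i j (vec (v j))) (vec (v i))) ->
  forall x : 'I_m -> L, 0 <= \sum_i \sum_j inner (X i j (x j)) (x i).
Proof.
move=> Xv x; set z := \sum_i _.
pose C : R := \sum_i \sum_j opnorm (X i j) * (hnorm (x i) + hnorm (x j) + 1).
have near k : exists y, 0 <= y /\ normc (z - y) <= C * k.+1%:R^-1.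
  set e : R := k.+1%:R^-1; have e0 : 0 < e by rewrite invr_gt0.
  have e1 : e <= 1 by rewrite invf_le1 // ler1n.
  have /choice[v vP] i := vec_dense vecP (x i) e0.
  exists (\sum_i \sum_j inner (X i j (vec (v j))) (vec (v i))); split=> //.
  rewrite /z -sumrB /C mulr_suml; apply: le_trans (normc_sum _ _) _.
  apply: ler_sum => i _; rewrite -sumrB mulr_suml.
  apply: le_trans (normc_sum _ _) _; apply: ler_sum => j _.
  have -> : inner (X i j (x j)) (x i) - inner (X i j (vec (v j))) (vec (v i)) =
      inner (X i j (x j - vec (v j))) (x i) +
      inner (X i j (vec (v j))) (x i - vec (v i)).
    by rewrite bopB innerBl innerBr addrA subrK.
  apply: le_trans (normcD _ _) _.
  have := opnorm_inner (X i j) (x j - vec (v j)) (x i).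
  have := opnorm_inner (X i j) (vec (v j)) (x i - vec (v i)).
  have := vP i; have := vP j.
  have : hnorm (vec (v j)) <= hnorm (x j) + 1.
    have -> : vec (v j) = x j - (x j - vec (v j)) by rewrite subKr.
    by apply: le_trans (psdnormD _ _ _) _; rewrite psdnormN; have := vP j; lra.
  have := opnorm_ge0 (X i j); have := psdnorm_ge0 (hilbert_psd L) (x i); have := psdnorm_ge0 (hilbert_psd L) (x j).
  have := psdnorm_ge0 (hilbert_psd L) (vec (v j)); have := psdnorm_ge0 (hilbert_psd L) (x i - vec (v i)).
  have := psdnorm_ge0 (hilbert_psd L) (x j - vec (v j)).
  move: (opnorm (X i j)) (hnorm (x i)) (hnorm (x j)) (hnorm (vec (v j)))
    (hnorm (x i - _)) (hnorm (x j - _)) => o p q r s t t0 s0 r0 q0 p0 o0 rq te se.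
  move=> n1 n2; have h1 : o * t * p <= o * e * p by rewrite ler_wpM2r // ler_wpM2l.
  have h2 : o * r * s <= o * (q + 1) * e.
    by apply: ler_pM => //; [rewrite mulr_ge0 | rewrite ler_wpM2l].
  have -> : o * (p + q + 1) * e = o * e * p + o * (q + 1) * e by ring.
  by move: (le_trans n2 h1) (le_trans n1 h2) => {}h1 {}h2; exact: lerD.
apply/complex_ge0P; split.
  apply: (@le_add_small _ _ _ C) => k; have [y [/complex_ge0P[y0 _] zy]] := near k.
  have := le_trans (Re_le_normc _) zy; rewrite cReD cReN ler_norml.
  by move: (C * _) => e /andP[ez _]; rewrite -lerBlDr sub0r; lra.
apply/eqP; rewrite -normr_eq0 eq_le normr_ge0 andbT.
apply: (@le_add_small _ _ _ C) => k; have [y [/complex_ge0P[_ y0] zy]] := near k.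
rewrite add0r; apply: le_trans zy; apply: le_trans (Im_le_normc _).
by move: (z) (y) y0 => [a b] [c d] /= ->; rewrite subr0.
Qed.

(** On vectors v_i of D the quadratic form is the value of psi at the positive
    operator sum_ij v_i^* A_ij v_j. *)
Lemma compress_cp : completely_positive setT compress.
Proof.
split=> [c a b _ _|m A _ A0]; first exact: compress_linear.
apply: quadratic_dense_ge0 => v.
pose X := \sum_i \sum_j adj (op (v i)) * (A i j * op (v j)).
have -> : \sum_i \sum_j inner (map_mx compress A i j (vec (v j))) (vec (v i)) = psi X.
  rewrite /X (linear_on_sum subspace_setT psiP.1) //; apply: eq_bigr => i _.
  rewrite (linear_on_sum subspace_setT psiP.1) //; apply: eq_bigr => j _.
  by rewrite mxE compress_inner.
apply: psiP.2 => // x; have := A0 (fun i => op (v i) x); congr (_ <= _).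
rewrite /X bop_sumE inner_suml.
apply: eq_bigr => i _.
rewrite bop_sumE inner_suml.
by apply: eq_bigr => j _; rewrite !bopME adjPr.
Qed.

Hypothesis DM : forall a b, vsub_set D a -> vsub_set D b -> vsub_set D (a * b).

Lemma compress_subvect b v u : op u = b * op v -> compress b (vec v) = vec u.
Proof.
move=> ub; apply: (vec_sep vecP) => w.
by rewrite compress_inner (vec_inner vecP) -[h u w]/(psi (adj (op w) * op u)) ub.
Qed.

Lemma compressM a b : vsub_set D b -> compress (a * b) = compress a * compress b.
Proof.
move=> Db; apply: bop_vec_ext => v w.
have [u ub] := subvect_ex (DM Db (subvectP v)).
by rewrite bopME (compress_subvect ub) !compress_inner ub (mulrA a).
Qed.

End OperatorForm.

Section Irreducibility.
Context {R : realType} {H : hilbertType R}.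
Variables (psi : bop H -> R[i]) (psiP : positive_functional setT psi).
Variables (D : vsubspace (bop H)) (L : hilbertType R) (vec : subvect D -> L).
Hypothesis vecP : is_completion (subspace_form psiP D) vec.
Hypothesis Dsys : operator_system (vsub_set D).
Hypothesis DM : forall a b, vsub_set D a -> vsub_set D b -> vsub_set D (a * b).
Hypothesis psi_pure : pure (vsub_set D) psi.
Local Notation T := (compress vecP).
Local Notation op u := (subvect_val u : bop H).

Let Dadj a : vsub_set D a -> vsub_set D (adj a).
Proof. by case: Dsys => _ _; exact. Qed.

(** For an invariant closed subspace M with projection P and cyclic vector xi,
    the functional d |-> <T_d P xi, P xi> and its complement split psi. Purity
    makes it t psi, that is, P = t on a dense subspace. *)
Lemma pure_irreducible (M : set L) : subspace M -> closed M ->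
  (forall d x, vsub_set D d -> M x -> M (T d x)) -> M = [set 0] \/ M = setT.
Proof.
move=> Msub Mcl MT; have [M0 ML] := Msub.
have /choice[P PP] x : exists y, M y /\ forall m, M m -> inner m x = inner m y.
  have [|m _|y My yP] := @riesz_on R L M (fun w => inner w x) (hnorm x) Msub Mcl.
  - by move=> c u v _ _; rewrite innerDl innerZl.
  - by rewrite mulrC inner_CauchySchwarz.
  by exists y.
have MP x : M (P x) by case: (PP x).
have inner_P m x : M m -> inner m x = inner m (P x) by case: (PP x) => _; apply.
have P_unique x y : M y -> (forall m, M m -> inner m x = inner m y) -> P x = y.
  move=> My xy; apply/eqP; rewrite -subr_eq0; apply/eqP/hnorm_eq0/eqP.
  have Md : M (P x - y) by exact: (subspaceB Msub).
  have := inner_self (P x - y); rewrite innerBr -inner_P // xy // subrr.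
  by move=> /complexI/esym/eqP; rewrite expf_eq0.
(* M is invariant under T_d and its adjoint, so P commutes with T_d. *)
have PT d x : vsub_set D d -> P (T d x) = T d (P x).
  move=> Dd; apply: P_unique => [|m Mm]; first exact: MT.
  rewrite -!adjPr -compress_adj inner_P //; apply: MT => //; exact: Dadj.
have [one oneE] : {u : subvect D | op u = 1} by apply: subvect_ex; case: Dsys.
pose xi := vec one; pose p := P xi.
have vecE v : vec v = T (op v) xi.
  by rewrite (compress_subvect vecP (u := v)) // oneE mulr1.
have [r xiE r_perp] : exists2 r, xi = p + r & forall m, M m -> inner m r = 0.
  exists (xi - p); first by rewrite addrC subrK.
  by move=> m Mm; rewrite innerBr (inner_P m xi) // subrr.
have T_pos d x : positive_op d -> 0 <= inner (T d x) x.
  by move=> d0; apply: (cp_positive (compress_cp vecP) (a := d)).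
have T_lin (c : R[i]) a b x : inner (T (c *: a + b) x) x = c * inner (T a x) x + inner (T b x) x.
  by rewrite compress_linear bopDE bopZE innerDl innerZl.
have psiE d : psi d = inner (T d xi) xi.
  by rewrite /xi compress_inner oneE adj1 mul1r mulr1.
have split_psi d : vsub_set D d -> psi d - inner (T d p) p = inner (T d r) r.
  move=> Dd; rewrite psiE xiE.
  have Mp : M p by exact: MP.
  rewrite bopD !innerDl !innerDr (r_perp (T d p)); last exact: MT.
  have -> : inner (T d r) p = 0.
    rewrite adjP -compress_adj innerC r_perp ?conjc0 //.
    by apply: MT => //; exact: Dadj.
  by rewrite addr0 add0r addrC addKr.
have [||t t01 gt] := psi_pure (g := fun d => inner (T d p) p).
- apply/(cp_functionalP _ (vsub_subspace D)); split=> [c a b _ _|a _ a0].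
    exact: (T_lin c a b p).
  exact: T_pos.
- apply/(cp_functionalP _ (vsub_subspace D)); split=> [c a b Da Db|a Da a0] /=.
    have Dab := (vsub_subspace D).2 c a b Da Db.
    rewrite (split_psi _ Dab) (split_psi _ Da) (split_psi _ Db).
    exact: (T_lin c a b r).
  by rewrite split_psi //; exact: T_pos.
have P_vec v : P (vec v) = t%:C *: vec v.
  apply: (vec_sep vecP) => w.
  have Dv := subvectP v; have Dw := Dadj (subvectP w).
  have Dwv : vsub_set D (adj (op w) * op v) by exact: DM.
  have -> : inner (P (vec v)) (vec w) = inner (T (adj (op w) * op v) p) xi.
    by rewrite compressM // bopME compress_adj adjPr -vecE -(PT _ xi Dv) -vecE.
  rewrite inner_P; last by apply: MT => //; exact: MP.
  by rewrite -/p (gt _ Dwv) innerZl (vec_inner vecP).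
have P_sym x y : inner (P x) y = inner x (P y).
  by rewrite (inner_P _ y (MP x)) [RHS]innerC (inner_P _ x (MP y)) -innerC.
have PE x : P x = t%:C *: x.
  apply: (vec_sep vecP) => w.
  by rewrite P_sym P_vec innerZr conjc_real innerZl.
have [t0|t0] := eqVneq (t%:C : R[i]) 0.
  left; apply/seteqP; split=> x /=; last by move=> ->.
  by move=> Mx; rewrite -(P_unique x x) // PE t0 scale0r.
right; apply/seteqP; split=> // x _.
by rewrite -(scale1r x) -(mulVf t0) -scalerA -PE; exact: (subspaceZ Msub).
Qed.

End Irreducibility.

(** * The equivalence *)

Section Agreement.
Context {R : realType} {K H : hilbertType R}.
Variables (S A : set (bop K)) (pi Pi : bop K -> bop H).
Hypotheses (S_system : operator_system S) (AE : A = Cstar S).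
Hypothesis S_boundary : forall (L : hilbertType R) (rho : bop K -> bop L),
  irreducible_representation A rho -> boundary_representation S rho.
Hypotheses (pi_rep : star_representation A pi) (pi1 : pi 1 = 1).
Hypotheses (Pi_cp : completely_positive A Pi) (Pi1 : Pi 1 = 1).
Hypothesis Pi_pi : forall s, S s -> Pi s = pi s.

Local Notation B := (Cstar (Pi @` A)).
Local Notation D := (pi @` A).

Lemma source_Cstar : Cstar_subalgebra A.
Proof. by rewrite AE; exact: Cstar_subalgebraP. Qed.

Lemma source_unit : A 1.
Proof. by rewrite AE; apply: Cstar_sub; case: S_system. Qed.

Lemma target_system : operator_system B.
Proof. by apply: Cstar_system; exists 1; [exact: source_unit|]. Qed.

Lemma image_system : operator_system D.
Proof. exact: representation_image_system source_Cstar source_unit pi_rep pi1. Qed.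

Lemma image_sub_target : D `<=` B.
Proof.
move=> _ [a Aa <-].
apply: (representation_Cstar_sub source_Cstar source_unit pi_rep pi1 AE) Aa.
  exact: Cstar_subalgebraP.
move=> s Ss; rewrite -Pi_pi //; apply: Cstar_sub; exists s => //.
by rewrite AE; exact: Cstar_sub.
Qed.

Lemma target_in_closure : Pi @` A `<=` D -> B `<=` norm_closure D.
Proof.
move=> PiD; apply: Cstar_min; last by move=> b /PiD; exact: norm_closure_sub.
apply: norm_closure_Cstar; first exact: image_system.
by move=> a b; exact: (representation_imageM source_Cstar pi_rep).
Qed.

(** Extend f to all operators and let the compressions T_b act on the completion
    of pi(A). Since f is pure on pi(A), a |-> T_(pi a) is an irreducible
    representation of A, and a |-> T_(Pi a) is a completely positive map that
    agrees with it on S. The hypothesis on irreducible representations makes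
    them equal; now evaluate at the cyclic vector. *)
Lemma pure_restriction_agree f : state B f -> pure_state D f ->
  forall a, A a -> f (Pi a) = f (pi a).
Proof.
have [Dsub D1 Dadj] := image_system; have [Bsub _ _] := target_system.
move=> [/(cp_functionalP _ Bsub) fP f1] [_ f_pure].
have [psi psiP psiE] := positive_extension target_system fP.
have psiD d : D d -> psi d = f d by move=> /image_sub_target/psiE.
pose V := VSubspace Dsub.
have DM a b : D a -> D b -> D (a * b).
  exact: (representation_imageM source_Cstar pi_rep).
have psi_pure : pure (vsub_set V) psi.
  move=> g gP /(cp_functionalP _ Dsub) [psi_gL psi_g0].
  have [|t t01 gt] := f_pure g gP.
    apply/(cp_functionalP _ Dsub); split=> [c a b Da Db|a Da a0] /=.
      by rewrite -!psiD //; [exact: psi_gL | exact: Dsub.2].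
    by rewrite -psiD //; exact: psi_g0.
  by exists t => // a Da; rewrite gt // psiD.
have [L [vec vecP]] := completion_exists (subspace_form psiP V).
have [piL piM pi_adj] := pi_rep.
have DA a : A a -> D (pi a) by exists a.
have [one oneE] : {u : subvect V | (subvect_val u : bop H) = 1} by exact: subvect_ex.
have T_one b : inner (compress vecP b (vec one)) (vec one) = psi b.
  by rewrite compress_inner oneE adj1 mul1r mulr1.
have irr : irreducible_representation A (compress vecP \o pi).
  split.
  - split=> [c a b Aa Ab|a b Aa Ab|a Aa] /=.
    + by rewrite piL // compress_linear.
    + by rewrite piM // compressM //; exact: DA.
    + by rewrite pi_adj // compress_adj.
  - exists 1; first exact: source_unit.
    apply/negP => /eqP /= T0; have := T_one (pi 1).
    rewrite T0 bop0E inner0l pi1 psiD // f1 => /eqP.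
    by rewrite eq_sym oner_eq0.
  - move=> M Msub Mcl MA.
    apply: (pure_irreducible (vecP := vecP) image_system DM psi_pure Msub Mcl).
    by move=> _ x [a Aa <-]; exact: MA.
have [_ uep] := S_boundary irr.
have TPi a : A a -> compress vecP (Pi a) = compress vecP (pi a).
  rewrite AE => Aa; apply: (uep (compress vecP \o Pi)) => //= [|s Ss]; last by rewrite Pi_pi.
  rewrite -AE; split=> [c a' b Aa' Ab|n X AX X0] /=.
    by rewrite Pi_cp.1 // compress_linear.
  rewrite map_mx_comp; apply: (compress_cp vecP).2 => //.
  exact: Pi_cp.2.
move=> a Aa; have BPi : B (Pi a) by apply: Cstar_sub; exists a.
by rewrite -(psiD _ (DA a Aa)) -(psiE _ BPi) -!T_one TPi.
Qed.

End Agreement.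

Theorem theorem1p1 (R : realType) (K H : hilbertType R)
    (S : set (bop K)) (A : set (bop K)) (pi Pi : bop K -> bop H)
    (S_system : operator_system S)
    (AE : A = Cstar S)
    (S_boundary : forall (L : hilbertType R) (rho : bop K -> bop L),
      irreducible_representation A rho -> boundary_representation S rho)
    (pi_rep : star_representation A pi) (pi1 : pi 1 = 1)
    (Pi_cp : completely_positive A Pi) (Pi1 : Pi 1 = 1)
    (Pi_pi : forall s, S s -> Pi s = pi s) :
  [<->
   (* (i) *) forall a, A a -> pi a = Pi a;
   (* (ii) *) Pi @` A `<=` pi @` A;
   (* (iii) *) forall f, pure_state (Cstar (Pi @` A)) f -> pure_state (pi @` A) f;
   (* (iv) *) exists F : set (bop H -> R[i]),
     [/\ forall f, F f -> state (Cstar (Pi @` A)) f,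
         separates F [set Pi a - pi a | a in A]
       & forall f, F f -> pure_state (pi @` A) f];
   (* (v) *) forall f, pure_state (Cstar (Pi @` A)) f ->
     unique_extension (pi @` A) (Cstar (Pi @` A)) f;
   (* (vi) *) exists F : set (bop H -> R[i]),
     [/\ forall f, F f -> pure_state (Cstar (Pi @` A)) f,
         separates F [set Pi a - pi a | a in A]
       & forall f, F f -> unique_extension (pi @` A) (Cstar (Pi @` A)) f]].
Proof.
have AC := source_Cstar AE; have A1 := source_unit S_system AE.
have [Asub _ Aadj _] := AC; have Asys : operator_system A by [].
have Bsys := target_system S_system AE Pi1; have [Bsub _ _] := Bsys.
have Dsys := image_system S_system AE pi_rep pi1.
have DB := image_sub_target S_system AE pi_rep pi1 Pi_pi.
have PiB a : A a -> Cstar (Pi @` A) (Pi a) by move=> Aa; apply: Cstar_sub; exists a.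
have Pi_adj a : A a -> Pi (adj a) = adj (Pi a).
  move=> Aa; apply/eqP; rewrite -subr_eq0; apply/eqP/bop_quadratic_eq0 => x.
  have fP : positive_functional A (fun a => inner (Pi a x) x).
    split=> [c u v Au Av|u Au u0]; first by rewrite Pi_cp.1 // bopDE bopZE innerDl innerZl.
    exact: (cp_positive Pi_cp Au).
  rewrite bopBE innerBl (functional_adj Asys fP) // adjPr [X in _ - X]innerC.
  by rewrite subrr.
(* Under (ii) pi(A) is norm dense in C*(Pi(A)). *)
have dense_uep f : Pi @` A `<=` pi @` A -> pure_state (Cstar (Pi @` A)) f ->
    unique_extension (pi @` A) (Cstar (Pi @` A)) f.
  move=> PiD [[/(cp_functionalP _ Bsub) fP _] _].
  apply: dense_unique_extension => //.
  exact: (target_in_closure S_system AE pi_rep pi1 PiD).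
have separating : separates [set f | pure_state (Cstar (Pi @` A)) f]
    [set Pi a - pi a | a in A].
  move=> _ [a Aa <-] s_sa s0; set s := Pi a - pi a in s_sa s0 *.
  have Bs : Cstar (Pi @` A) s.
    by apply: (subspaceB Bsub); [exact: PiB | apply: DB; exists a].
  have [f fP fs] := pure_states_separate Bsys Bs s_sa s0.
  apply: (@lt_le_trans _ _ (Normc.normc (f s))%:E); last first.
    by apply: ereal_sup_ubound; exists f.
  rewrite lte_fin lt_def normc_ge0 andbT.
  by apply: contra fs => /eqP/normc_eq0 ->.
have iv_i : (exists F : set (bop H -> R[i]),
     [/\ forall f, F f -> state (Cstar (Pi @` A)) f,
         separates F [set Pi a - pi a | a in A]
       & forall f, F f -> pure_state (pi @` A) f]) -> forall a, A a -> pi a = Pi a.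
  move=> [F [Fst Fsep Fpure]].
  have [piL _ pi_adj] := pi_rep; have PiL := Pi_cp.1.
  have agree f a : F f -> A a -> f (Pi a - pi a) = 0.
    move=> Ff Aa; have [[fL _] _] := Fst f Ff.
    rewrite (linear_onB Bsub fL (PiB _ Aa)); last by apply: DB; exists a.
    by rewrite (pure_restriction_agree S_system AE S_boundary pi_rep pi1 Pi_cp Pi1 Pi_pi
      (Fst f Ff) (Fpure f Ff) Aa) subrr.
  have sa a : A a -> adj a = a -> pi a = Pi a.
    move=> Aa aa; apply/esym/eqP; rewrite -subr_eq0; apply: contrapT => /negP s0.
    have s_sa : adj (Pi a - pi a) = Pi a - pi a.
      by rewrite adjB -Pi_adj // -pi_adj // aa.
    have Fs := Fsep _ (ex_intro2 _ _ a Aa erefl) s_sa s0.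
    move: Fs; apply/negP; rewrite -leNgt; apply: ge_ereal_sup => _ [f Ff <-].
    by rewrite agree // normc0.
  move=> a Aa; have Aa' := Aadj _ Aa; pose s := Pi a - pi a.
  have s_adj : Pi (adj a) - pi (adj a) = adj s by rewrite adjB Pi_adj // pi_adj.
  have s1 : s + adj s = 0.
    rewrite -s_adj /s addrACA -opprD -(linear_onD PiL Aa Aa') -(linear_onD piL Aa Aa').
    rewrite sa ?subrr //; first exact: (subspaceD Asub).
    by rewrite adjD adjK addrC.
  (* Both a + a^* and i (a - a^* ) are self-adjoint. *)
  have s2 : s = adj s.
    have Ad : A (a - adj a) by exact: (subspaceB Asub).
    have : 'i%C *: (s - adj s) = 0.
      rewrite -s_adj /s opprD addrACA -opprD.
      rewrite -(linear_onB Asub PiL Aa Aa') -(linear_onB Asub piL Aa Aa') scalerBr.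
      rewrite -(linear_onZ Asub PiL _ Ad) -(linear_onZ Asub piL _ Ad).
      rewrite sa ?subrr //; first exact: (subspaceZ Asub).
      rewrite adjZ adjB adjK -[a - adj a]opprB scalerN -scaleNr; congr (_ *: _).
      by apply/eqP; rewrite eq_complex /= oppr0 !eqxx.
    move/eqP; rewrite scaler_eq0 subr_eq0 => /orP[|/eqP //].
    by rewrite eq_complex /= oner_eq0 andbF.
  have : 2%:R *: s = 0 by rewrite scaler_nat mulr2n {2}s2.
  move/eqP; rewrite scaler_eq0 pnatr_eq0 /= /s subr_eq0 => /eqP ->//.
have i_ii : (forall a, A a -> pi a = Pi a) -> Pi @` A `<=` pi @` A.
  by move=> piPi _ [a Aa <-]; exists a => //; exact: piPi.
tfae.
- exact: i_ii.
- move=> PiD f fP; apply: (pure_state_restrict Dsys Bsys DB fP).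
  exact: dense_uep.
- move=> pure_pure; exists [set f | pure_state (Cstar (Pi @` A)) f]; split=> //.
  by move=> f [].
(* The passage from (iv) to (v) goes through (i) and (ii). *)
- by move=> /iv_i/i_ii PiD f; exact: dense_uep.
- move=> uep; exists [set f | pure_state (Cstar (Pi @` A)) f]; split=> //.
- move=> [F [Fpure Fsep Fuep]]; apply: iv_i; exists F; split=> // f Ff.
    by have [] := Fpure f Ff.
  exact: (pure_state_restrict Dsys Bsys DB (Fpure f Ff) (Fuep f Ff)).
Qed.
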